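(* Let $a,b,c$ be distinct primes with $a<b$ and $N(a,b,c)>1$, and suppose $(a,b,c)\notin\{(2,3,5),(2,3,11),(2,5,3),(2,7,3),(3,5,2),(3,13,2)\}$. Then $c\equiv 5\pmod{12}$, and the equation $a^x+b^y=c^z$ has exactly two solutions $(x_1,y_1,z_1)$ and $(x_2,y_2,z_2)$ in positive integers, which (after suitable labeling) satisfy $2\mid x_1$, $2\mid y_1$, $z_1=1$, and $2\nmid y_2$.
   Context: $N(a,b,c)$ denotes the number of triples $(x,y,z)$ of positive integers with $a^x+b^y=c^z$. *)

(* Defs.v *)
From mathcomp Require Import all_boot.
Set Implicit Arguments.
Unset Strict Implicit.
Unset Printing Implicit Defensive.

Definition is_sol (a b c : nat) (t : nat * nat * nat) : Prop :=
  let: (x, y, z) := t in 0 < x /\ 0 < y /\ 0 < z /\ a ^ x + b ^ y = c ^ z.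

Definition N_gt1 (a b c : nat) : Prop :=
  exists t1 t2, t1 <> t2 /\ is_sol a b c t1 /\ is_sol a b c t2.

(* Main.v *)
From Stdlib Require Import Classical.
Require Import Defs.
From mathcomp Require Import all_boot all_order all_algebra all_field.
From mathcomp Require Import ring zify.

(**
  Fix the parities of [x] and [y].  A solution of [p ^ x + q ^ y = c ^ z] is an
  element [u sqrt P + v sqrt (- Q)] of norm [c ^ z] (with a denominator [2] when
  [c = 2]), where [P] and [Q] are the squarefree parts of [p ^ x] and [q ^ y].
  By descent on the norm, all such elements whose two parts keep the primes [p]
  and [q] are, up to sign and conjugation, odd powers of one of them.  Comparing
  coefficients, a power other than the first would have to have an exponent
  divisible by [p] or [q], and then its norm is too large: each parity class
  contains at most one solution, except for [(3, 5, 2)] and [(3, 13, 2)].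

  For [c = 2] two parity classes are incompatible because the powers of [2]
  dividing [p + 1] and [q - 1] or [q + 1] could be increased forever.  For
  [a = 2] congruences modulo [24] leave the class of even [x], [y] together with
  one class of odd [y], apart from the cases [b = 3] and [c = 3], which reduce to
  [2 + b ^ 2j = 3 ^ z] and to [2 + 3 ^ y1 = 2 ^ x + 3 ^ y2].  In the even class
  [c] is a sum of two squares by Thue's lemma, so the descent starts from the
  exponent [1]; this forces [z = 1] unless [c = 4 ^ k + 1], where a 2-adic argument
  leaves only [4 + 121 = 125].
*)

Set Implicit Arguments.
Unset Strict Implicit.
Unset Printing Implicit Defensive.
Import Order.TTheory GRing.Theory Num.Theory.

(** * Elementary congruences *)

(** The order of an ideal class is replaced by the least positive exponent [t] of an element of the
    required shape. Multiplying by the square of that element, or by the conjugate of the square,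
    shifts every other exponent by [2 t]; a square is taken because it has the form
    [r + s sqrt (- P Q)] up to the denominator, so that the shape [u sqrt P + v sqrt (- Q)] is
    preserved. Two obstacles shape the hypotheses of the descent: units other than [1] and [-1],
    which could occur for [P Q = 1] or [P Q = 3], and elements of norm [1], at which an exponent
    [2 t] would end. They are removed by prescribed divisors of [u] and [v], by size, by a
    congruence modulo 8, or by the parity of the exponents. For [a = 2] the congruences fix the
    parity of [x] once that of [y] is known, but they do not separate even [y] from odd [y]; this is
    why two solutions, and not one, remain. *)

Lemma odd_prime_ge3 r : prime r -> r <> 2%N -> odd r /\ (3 <= r)%N.
Proof.
move=> r_pr r2; have r1 := prime_gt1 r_pr; case: (even_prime r_pr) => // r_odd.
by split=> //; rewrite ltn_neqAle r1 andbT eq_sym; apply/eqP.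
Qed.

Lemma two_step_ind (P : nat -> Prop) :
  P 0%N -> P 1%N -> (forall m, P m -> P m.+1 -> P m.+2) -> forall m, P m.
Proof.
move=> P0 P1 PS m; suff [] : P m /\ P m.+1 by [].
by elim: m => [|m [Pm PSm]]; split=> //; apply: PS.
Qed.

Lemma pow_mod_period a m d x : a ^ d = 1 %[mod m] -> a ^ x = a ^ (x %% d) %[mod m].
Proof.
move=> ad; rewrite {1}(divn_eq x d) expnD mulnC [x %/ d * d]mulnC expnM.
by rewrite -modnMmr -[(a ^ d) ^ _ %% m]modnXm ad modnXm exp1n modnMmr muln1.
Qed.

(** Every unit modulo 24 has square 1, so only the parity of the exponent matters; hence the choice
    of 24 as modulus in the case analyses below. *)
Lemma pow_mod24 n z : odd n -> n %% 3 != 0 ->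
  n ^ z %% 24 = if odd z then n %% 24 else 1.
Proof.
move=> n_odd n3; have n2 : n ^ 2 = 1 %[mod 24].
  rewrite -modnXm; have : n %% 24 < 24 by rewrite ltn_mod.
  have : odd (n %% 24) by move: n_odd; clear; lia.
  have : (n %% 24) %% 3 != 0 by move: n3; clear; lia.
  by move: (n %% 24); do 24![case=> //].
by rewrite (pow_mod_period z n2) modn2; case: (odd z).
Qed.

Lemma exp2_mod24 x : 0 < x -> (2 ^ x) %% 24 =
  if x == 1 then 2 else if x == 2 then 4 else if odd x then 8 else 16.
Proof.
elim: x => // -[|[|x]] // IHx _; rewrite expnS -modnMmr IHx //=.
by case: x {IHx} => [|x] //=; rewrite negbK; case: (odd x).
Qed.

Lemma exp3_mod24 y : 0 < y -> (3 ^ y) %% 24 = if odd y then 3 else 9.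
Proof.
elim: y => // -[|y] // IHy _; rewrite expnS -modnMmr IHy //=.
by case: (odd y).
Qed.

Lemma prime_mod_6 n : prime n -> n <> 2 -> n <> 3 -> odd n /\ n %% 3 != 0.
Proof.
move=> n_pr n2 n3; split; first by case: (odd_prime_ge3 n_pr n2).
by apply/negP => /eqP /eqP; rewrite -/(3 %| n) dvdn_prime2 // => /eqP E; apply: n3.
Qed.

Lemma prime_of_pow (p q i j : nat) :
  prime p -> prime q -> 0 < j -> q ^ j = p ^ i -> q = p.
Proof.
move=> p_pr q_pr j0 E; have : q %| p ^ i by rewrite -E dvdn_exp.
by rewrite Euclid_dvdX // dvdn_prime2 // => /andP[/eqP].
Qed.

(** [C - B] and [C + B] are powers of two of the same parity, and their difference [2 * B] is not
    divisible by 4; so the smaller one is 2. *)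
Lemma diff_squares_exp2 x B C : odd B -> 0 < x -> 2 ^ x + B ^ 2 = C ^ 2 ->
  exists n, [/\ x = n.+2, B + 1 = 2 ^ n & C = 2 ^ n + 1].
Proof.
move=> B_odd x0 E.
have BC : B < C.
  rewrite ltnNge; apply/negP => CB; have : C ^ 2 <= B ^ 2 by rewrite leq_exp2r.
  have : 0 < 2 ^ x by rewrite expn_gt0.
  by move: E; clear; lia.
have EBC : (C - B) * (C + B) = 2 ^ x by rewrite -subn_sqr -E addnK.
have /(dvdn_pfactor _ _ (isT : prime 2))[s _ sE] : C - B %| 2 ^ x by rewrite -EBC dvdn_mulr.
have /(dvdn_pfactor _ _ (isT : prime 2))[r _ rE] : C + B %| 2 ^ x by rewrite -EBC dvdn_mull.
have B0 : 0 < B by case: (B) B_odd.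
case: s sE => [|[|s]] sE.
- have : odd (2 ^ r) by rewrite -rE; move: sE BC B0; rewrite expn0; clear; lia.
  rewrite oddX orbF => /eqP r0; move: rE sE; rewrite r0 !expn0.
  by move: BC B0; clear; lia.
- case: r rE => [|r] rE; first by move: rE sE BC B0; rewrite expn0; clear; lia.
  rewrite expnS in rE; exists r; split.
  + apply/eqP; rewrite -(eqn_exp2l _ _ (isT : 1 < 2)) -EBC sE rE !expnS; apply/eqP.
    by clear; lia.
  + by move: rE sE BC; clear; lia.
  + by move: rE sE BC; clear; lia.
- case: r rE => [|[|r]] rE.
  + by move: rE sE BC B0; rewrite expn0; clear; lia.
  + have : 0 < 2 ^ s by rewrite expn_gt0.
    by move: rE sE BC B0; rewrite !expnS; clear; lia.
  + by move: rE sE BC B_odd; rewrite !expnS; clear; lia.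
Qed.

Lemma exp2_add1_exp3 n k : 2 ^ n + 1 = 3 ^ k -> n = 1 \/ n = 3.
Proof.
case: n => [|[|n]] E; [| by left | right].
  case: k E => [|k]; rewrite ?expn0 // expnS; clear; lia.
have k_even : odd k = false.
  apply/negP => k_odd; have := exp3_mod24 (odd_gt0 k_odd); rewrite k_odd -E !expnS.
  by clear; lia.
have kE : k = k./2.*2 by rewrite -{1}(odd_double_half k) k_even.
have {}E : 2 ^ n.+2 + 1 ^ 2 = (3 ^ k./2) ^ 2 by rewrite -expnM muln2 -kE -E.
have [m [-> mE _]] := diff_squares_exp2 (isT : odd 1) (isT : 0 < n.+2) E.
case: m mE => [|[|m]] //; rewrite !expnS.
have : 0 < 2 ^ m by rewrite expn_gt0.
by clear; lia.
Qed.

(** For [y2 = 1] the equation becomes [2 ^ x + 1 = 3 ^ y1]. For [y2 > 1], reduction modulo 9 gives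
    [x = 1] modulo 6, hence [2 ^ x = 2] modulo 7; as 3 is a primitive root modulo 7, [y1] and [y2]
    agree modulo 6, against their parities. *)
Lemma pillai_2_3 x y1 y2 : 2 < x -> odd y1 = false -> odd y2 -> 0 < y1 ->
  2 + 3 ^ y1 = 2 ^ x + 3 ^ y2 -> 2 ^ x + 3 ^ y2 = 11.
Proof.
move=> x3 y1_even y2_odd y10 E.
have [y21|y22] : y2 = 1 \/ 1 < y2 by move: y2_odd; case: y2 {E} => [|[|y2]] //; [left|right].
  have E' : 2 ^ x + 1 = 3 ^ y1 by move: E; rewrite y21; clear; lia.
  case: (exp2_add1_exp3 E') => xE; move: x3; rewrite xE // => _.
  by rewrite y21.
exfalso; have y12 : 1 < y1 by move: y10 y1_even; case: (y1) => [|[]].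
have m9 : 2 ^ x %% 9 = 2.
  have : 9 %| 3 ^ y1 by rewrite -[9]/(3 ^ 2) dvdn_exp2l.
  have : 9 %| 3 ^ y2 by rewrite -[9]/(3 ^ 2) dvdn_exp2l.
  by move: E; clear; lia.
have x6 : x %% 6 = 1.
  move: m9; rewrite (pow_mod_period x (_ : 2 ^ 6 = 1 %[mod 9])) //.
  have : x %% 6 < 6 by rewrite ltn_mod.
  by move: (x %% 6); do 6![case=> //].
have m7 : 2 ^ x %% 7 = 2.
  rewrite (pow_mod_period x (_ : 2 ^ 6 = 1 %[mod 7])) // x6 //.
have p7 y : 3 ^ y = 3 ^ (y %% 6) %[mod 7] by apply: pow_mod_period.
have : 3 ^ (y1 %% 6) = 3 ^ (y2 %% 6) %[mod 7].
  by rewrite -!p7; move: E m7; clear; lia.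
have : y1 %% 6 < 6 by rewrite ltn_mod.
have : y2 %% 6 < 6 by rewrite ltn_mod.
have : odd (y1 %% 6) = false by move: y1_even; clear; lia.
have : odd (y2 %% 6) by move: y2_odd; clear; lia.
move: (y1 %% 6) (y2 %% 6) => a b.
by move: a; do 6![case; first by move: b; do 6![case=> //]]; [].
Qed.

Local Open Scope ring_scope.

(** * Lucas quotients *)

Section LucasQuotients.
Variable R : comNzRingType.
Implicit Types A N T M : R.

Fixpoint lucas_rec T M (w0 w1 : R) m : R :=
  if m is m'.+1 then lucas_rec T M w1 (T * w1 - M * w0) m' else w0.

Lemma lucas_recSS T M w0 w1 m :
  lucas_rec T M w0 w1 m.+2 =
  T * lucas_rec T M w0 w1 m.+1 - M * lucas_rec T M w0 w1 m.
Proof. by elim: m w0 w1 => [|m IHm] w0 w1 //; exact: IHm. Qed.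

(* If [g + h = X] and [g * h = N], the Lucas quotients at [A = X ^+ 2] are
   [vquo A N m = (g ^+ m.*2.+1 + h ^+ m.*2.+1) / (g + h)] and
   [uquo A N m = (g ^+ m.*2.+1 - h ^+ m.*2.+1) / (g - h)]. *)
Definition vquo A N := lucas_rec (A - 2 * N) (N ^+ 2) 1 (A - 3 * N).
Definition uquo A N := lucas_rec (A - 2 * N) (N ^+ 2) 1 (A - N).

Lemma vquo0 A N : vquo A N 0 = 1. Proof. by []. Qed.
Lemma vquo1 A N : vquo A N 1 = A - 3 * N. Proof. by []. Qed.
Lemma uquo0 A N : uquo A N 0 = 1. Proof. by []. Qed.
Lemma uquo1 A N : uquo A N 1 = A - N. Proof. by []. Qed.

Lemma vquoSS A N m :
  vquo A N m.+2 = (A - 2 * N) * vquo A N m.+1 - N ^+ 2 * vquo A N m.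
Proof. exact: lucas_recSS. Qed.

Lemma uquoSS A N m :
  uquo A N m.+2 = (A - 2 * N) * uquo A N m.+1 - N ^+ 2 * uquo A N m.
Proof. exact: lucas_recSS. Qed.

Lemma vquo_closed (g h : R) m :
  (g + h) * vquo ((g + h) ^+ 2) (g * h) m = g ^+ m.*2.+1 + h ^+ m.*2.+1.
Proof.
elim/two_step_ind: m => [||m IH0 IH1]; first by rewrite ?(vquo0, vquo1); ring.
  by rewrite ?(vquo0, vquo1); ring.
rewrite vquoSS.
transitivity (((g + h) ^+ 2 - 2 * (g * h)) *
    ((g + h) * vquo ((g + h) ^+ 2) (g * h) m.+1) -
  (g * h) ^+ 2 * ((g + h) * vquo ((g + h) ^+ 2) (g * h) m)); first by ring.
by rewrite IH1 IH0 !doubleS !exprS; ring.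
Qed.

(** Replacing [h] by [- h] turns [uquo A N] into [vquo (A - 4 * N) (- N)], and [vquo] is homogeneous
    of degree [m] in its two arguments. Facts about [vquo] thus pass to [uquo] by exchanging the
    roles of [p] and [q]. *)
Lemma uquo_vquo A N m : uquo A N m = (-1) ^+ m * vquo (4 * N - A) N m.
Proof.
elim/two_step_ind: m => [||m IH0 IH1]; rewrite ?uquoSS ?vquoSS ?IH0 ?IH1.
- by rewrite ?(vquo0, vquo1, uquo0, uquo1); ring.
- by rewrite ?(vquo0, vquo1, uquo0, uquo1); ring.
- by rewrite !exprS; ring.
Qed.

End LucasQuotients.

Section IntegerQuotients.
Implicit Types A N : int.

(** With [Y ^+ 2 = A - 4 * N] one has [2 * g ^+ m.*2.+1 = X * vquo A N m + Y * uquo A N m], and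
    these are the coefficients after multiplication by [g ^+ 2]. In the same way [quo_back] is
    multiplication by [h ^+ 2], and [quo_norm] takes the norm. *)
Lemma quo_step A N m :
  2 * vquo A N m.+1 = (A - 2 * N) * vquo A N m - (4 * N - A) * uquo A N m /\
  2 * uquo A N m.+1 = (A - 2 * N) * uquo A N m + A * vquo A N m.
Proof.
elim: m => [|m [IHv IHu]]; first by rewrite ?(vquo0, vquo1, uquo0, uquo1); split; ring.
rewrite vquoSS uquoSS; split; apply: (@mulfI _ (2 : int)) => //.
- transitivity (2 * (A - 2 * N) * (2 * vquo A N m.+1) -
    4 * N ^+ 2 * vquo A N m); first by ring.
  transitivity ((A - 2 * N) * (2 * vquo A N m.+1) -
    (4 * N - A) * (2 * uquo A N m.+1)); last by ring.
  by rewrite IHv IHu; ring.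
- transitivity (2 * (A - 2 * N) * (2 * uquo A N m.+1) -
    4 * N ^+ 2 * uquo A N m); first by ring.
  transitivity ((A - 2 * N) * (2 * uquo A N m.+1) +
    A * (2 * vquo A N m.+1)); last by ring.
  by rewrite IHv IHu; ring.
Qed.

Lemma quo_back A N m :
  (A - 2 * N) * vquo A N m.+1 + (4 * N - A) * uquo A N m.+1 =
    2 * N ^+ 2 * vquo A N m.
Proof.
have [Ev Eu] := quo_step A N m; apply: (@mulfI _ (2 : int)) => //.
transitivity ((A - 2 * N) * (2 * vquo A N m.+1) +
  (4 * N - A) * (2 * uquo A N m.+1)); first by ring.
by rewrite Ev Eu; ring.
Qed.

Lemma quo_norm A N m :
  A * vquo A N m ^+ 2 + (4 * N - A) * uquo A N m ^+ 2 = 4 * N ^+ m.*2.+1.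
Proof.
elim: m => [|m IHm]; first by rewrite ?(vquo0, vquo1, uquo0, uquo1); ring.
have [Ev Eu] := quo_step A N m; apply: (@mulfI _ (4 : int)) => //.
transitivity (A * (2 * vquo A N m.+1) ^+ 2 +
  (4 * N - A) * (2 * uquo A N m.+1) ^+ 2); first by ring.
have -> : N ^+ m.+1.*2.+1 = N ^+ 2 * N ^+ m.*2.+1 by rewrite -exprD.
rewrite Ev Eu; transitivity (4 * N ^+ 2 *
  (A * vquo A N m ^+ 2 + (4 * N - A) * uquo A N m ^+ 2)); first by ring.
by rewrite IHm; ring.
Qed.

Fixpoint sum_sq m : nat := if m is m'.+1 then (sum_sq m' + m ^ 2)%N else 0%N.

Lemma sum_sqE m : (6 * sum_sq m = m * m.+1 * m.*2.+1)%N.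
Proof. by elim: m => [|m IHm] //=; rewrite mulnDr IHm; lia. Qed.

(** Expansion in [A] to second order. The factor [- N] on the left avoids the exponent [m - 1] in
    the linear term. *)
Lemma vquo_expand A N m : exists w : int,
  - N * vquo A N m =
    (- N) ^+ m.+1 * (m.*2.+1)%:Z + (- N) ^+ m * A * (sum_sq m)%:Z + A ^+ 2 * w.
Proof.
elim/two_step_ind: m => [||m [w0 IH0] [w1 IH1]].
- exists 0; change (0.*2.+1)%:Z with (1 : int).
  by change (sum_sq 0)%:Z with (0 : int); rewrite ?(vquo0, vquo1); ring.
- exists 0; change (1.*2.+1)%:Z with (3 : int).
  by change (sum_sq 1)%:Z with (1 : int); rewrite ?(vquo0, vquo1); ring.
exists ((- N) ^+ m.+1 * (sum_sq m.+1)%:Z + (A - 2 * N) * w1 - N ^+ 2 * w0).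
rewrite vquoSS.
transitivity ((A - 2 * N) * (- N * vquo A N m.+1) -
  N ^+ 2 * (- N * vquo A N m)); first by ring.
rewrite IH1 IH0.
have -> : (sum_sq m.+2)%:Z = (sum_sq m)%:Z + (m%:Z + 1) ^+ 2 + (m%:Z + 2) ^+ 2.
  by rewrite /=; lia.
have -> : (sum_sq m.+1)%:Z = (sum_sq m)%:Z + (m%:Z + 1) ^+ 2 by rewrite /=; lia.
have -> : (m.+2.*2.+1)%:Z = 2 * m%:Z + 5 by lia.
have -> : (m.+1.*2.+1)%:Z = 2 * m%:Z + 3 by lia.
have -> : (m.*2.+1)%:Z = 2 * m%:Z + 1 by lia.
by rewrite !exprS; ring.
Qed.

Lemma intr_vquo A N m : (vquo A N m)%:~R = vquo A%:~R N%:~R m :> algC.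
Proof.
elim/two_step_ind: m => [||m IH0 IH1].
- by rewrite !vquo0.
- by rewrite !vquo1 rmorphB rmorphM.
- by rewrite !vquoSS !(rmorphB, rmorphXn, rmorphM) /= IH0 IH1.
Qed.

(** The powers of [g] and [h] with exponent [m.*2.+1] have sum [X * vquo A N m] and product
    [N ^+ m.*2.+1]; the closed form is applied to them again. The roots [g] and [h] live in [algC],
    and [A != 0] allows [X] to be cancelled. *)
Lemma vquo_comp A N m n : A != 0 ->
  vquo A N (m + n * m.*2.+1) =
    vquo A N m * vquo (A * vquo A N m ^+ 2) (N ^+ m.*2.+1) n.
Proof.
move=> A0; pose X : algC := sqrtC A%:~R.
have XX : X ^+ 2 = A%:~R by rewrite sqrtCK.
have X0 : X != 0 by rewrite sqrtC_eq0 intr_eq0.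
pose Y : algC := sqrtC (A%:~R - 4 * N%:~R).
have YY : Y ^+ 2 = A%:~R - 4 * N%:~R by rewrite sqrtCK.
pose g := (X + Y) / 2; pose h := (X - Y) / 2.
have two0 : (2 : algC) != 0 by rewrite pnatr_eq0.
have gh : g + h = X by rewrite /g /h; field.
have ghN : g * h = N%:~R.
  have -> : g * h = (X ^+ 2 - Y ^+ 2) / 4 by rewrite /g /h; field.
  by rewrite XX YY; field.
have clo k : X * vquo A%:~R N%:~R k = g ^+ k.*2.+1 + h ^+ k.*2.+1.
  by rewrite -vquo_closed gh ghN XX.
apply: (@intr_inj algC); apply: (mulfI X0).
rewrite rmorphM /= !intr_vquo !(rmorphXn, rmorphM) /= !intr_vquo clo mulrA clo.
have := vquo_closed (g ^+ m.*2.+1) (h ^+ m.*2.+1) n.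
rewrite -exprMn ghN -!exprM.
have -> : (m.*2.+1 * n.*2.+1)%N = (m + n * m.*2.+1).*2.+1 by lia.
by move=> <-; congr (_ * vquo _ _ _); rewrite -clo exprMn XX.
Qed.

Lemma vquo_dvd A N m n : A != 0 ->
  (vquo A N m %| vquo A N (m + n * m.*2.+1))%Z.
Proof. by move=> A0; rewrite vquo_comp // dvdz_mulr. Qed.

Lemma absz_uquo A N m : `|uquo A N m|%N = `|vquo (4 * N - A) N m|%N.
Proof. by rewrite uquo_vquo abszMsign. Qed.

Lemma uquo_dvd A N m n : 4 * N - A != 0 ->
  (uquo A N m %| uquo A N (m + n * m.*2.+1))%Z.
Proof. by move=> A0; rewrite dvdzE !absz_uquo -dvdzE vquo_dvd. Qed.

End IntegerQuotients.

(** * Prime powers among the Lucas quotients *)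

Lemma Euclid_dvdzM (p : nat) (x y : int) : prime p ->
  (p %| x * y)%Z = (p %| x)%Z || (p %| y)%Z.
Proof. by move=> p_pr; rewrite !dvdzE abszM /= Euclid_dvdM. Qed.

Lemma Euclid_dvdzX (p n : nat) (x : int) : prime p ->
  (p %| x ^+ n)%Z = (p %| x)%Z && (0 < n)%N.
Proof. by move=> p_pr; rewrite !dvdzE abszX /= Euclid_dvdX. Qed.

Lemma sqr_absz (x : int) : x ^+ 2 = (`|x| ^ 2)%N%:Z.
Proof. by rewrite expr2 -mulnn PoszM abszE -!normrM ger0_norm // -expr2 sqr_ge0. Qed.

Lemma prime_dvd_vquo (p m : nat) (A N : int) :
  prime p -> (p %| A)%Z -> ~~ (p %| N)%Z ->
  (p %| vquo A N m)%Z = (p %| m.*2.+1)%N.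
Proof.
move=> p_pr pA pN; have [w Ew] := vquo_expand A N m.
have pNN : (p %| - N)%Z = false by rewrite dvdzE abszN -dvdzE; apply: negbTE.
have <- : (p %| - N * vquo A N m)%Z = (p %| vquo A N m)%Z.
  by rewrite Euclid_dvdzM // pNN.
rewrite Ew -addrA rpredDr; last first.
  rewrite rpredD //; first by rewrite dvdz_mulr // dvdz_mull.
  by rewrite expr2 -mulrA dvdz_mulr.
by rewrite Euclid_dvdzM // Euclid_dvdzX // pNN.
Qed.

(** At the index [p] the constant term of the expansion is [p] times a unit modulo [p]. The linear
    term is divisible by [p ^ 2], because for [p > 3] the sum of squares [sum_sq p./2] is a multiple
    of [p]; this fails for [p = 3], which is the source of the exceptional pairs. *)
Lemma prime_sq_ndvd_vquo (p : nat) (A N : int) :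
  prime p -> (3 < p)%N -> (p %| A)%Z -> ~~ (p %| N)%Z ->
  ~~ ((p ^ 2)%N %| vquo A N p./2)%Z.
Proof.
move=> p_pr p3 pA pN; have [w Ew] := vquo_expand A N p./2.
have p_odd : odd p by case: (even_prime p_pr) => // p2; rewrite p2 in p3.
have Ep : p./2.*2.+1 = p by rewrite -[RHS]odd_double_half p_odd.
apply/negP => pv; move: Ew; rewrite Ep.
have pS : (p %| sum_sq p./2)%N.
  have: (p %| 6 * sum_sq p./2)%N by rewrite sum_sqE Ep dvdn_mull.
  rewrite (_ : 6 = 2 * 3)%N // !Euclid_dvdM // (gtnNdvd _ p3) //.
  by rewrite (gtnNdvd (_ : (0 < 2)%N) (ltnW p3)).
have sqE : (p ^ 2)%N%:Z = p%:Z * p%:Z by rewrite -PoszM.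
move=> Ew; have: ((p ^ 2)%N %| (- N) ^+ p./2.+1 * p%:Z)%Z.
  have -> : (- N) ^+ p./2.+1 * p%:Z = - N * vquo A N p./2 -
     (- N) ^+ p./2 * A * sum_sq p./2 - A ^+ 2 * w by rewrite Ew; ring.
  rewrite rpredB ?rpredB //; first by rewrite dvdz_mull.
    by rewrite -mulrA dvdz_mull // sqE dvdz_mul.
  by rewrite dvdz_mulr // sqE expr2 dvdz_mul.
rewrite sqE dvdz_mul2r ?Euclid_dvdzX //; last by rewrite eqz_nat -lt0n prime_gt0.
by rewrite dvdzE abszN -dvdzE (negbTE pN).
Qed.

Lemma sqr_le_exp2 n : (7 <= n)%N -> (n ^ 2 <= 2 ^ n.-1)%N.
Proof.
elim: n => // n IHn; rewrite ltnS leq_eqVlt => /orP[/eqP <- //|n6].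
have {}IHn := IHn n6.
have -> : (n.+1.-1 = n.-1.+1)%N by lia.
rewrite [(2 ^ _)%N]expnS; apply: (@leq_trans (2 * n ^ 2)%N); last by rewrite leq_mul2l.
by rewrite -!mulnn; nia.
Qed.

(* The descent runs in the lattice of the numbers [(u sqrt P + v sqrt (- Q)) / l]:
   halves ([l = 2]) are needed exactly when [c = 2], and [k = 4 / l ^ 2]. *)
Definition scale_ok (k l c : nat) :=
  ([/\ l = 1, k = 4 & odd c] \/ [/\ l = 2, k = 1 & c = 2])%N.

Lemma exp3_mod3 i : ((3 ^ i) %% 3 = (i == 0))%N.
Proof. by case: i => // i; rewrite expnS modnMr. Qed.

Lemma odd_factor_half m h r :
  (m.*2.+1 = r * h.*2.+1 -> m = h + r./2 * h.*2.+1)%N.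
Proof.
move=> E; have r_odd : odd r.
  by move: (congr1 odd E); rewrite oddM /= !odd_double andbT.
have rE : r = (2 * r./2 + 1)%N by rewrite -{1}(odd_double_half r) r_odd; lia.
by move: E; rewrite {1}rE; nia.
Qed.

Lemma weighted_sum_lt (X Y N M w : nat) :
  (1 < w -> 0 < Y -> X + Y = 4 * N -> X * w + Y = 4 * M -> M < w * N)%N.
Proof. by nia. Qed.

(** For [p = 3] the two quotients of index 3 are [A - 3 * N] and [A - N]. Inserting [N = A + 1] or
    [N = A - 1] leaves [8 * 3 ^ e + 1] or [8 * 3 ^ e - 1] as a power of 3 (with 2 in place of 8 when
    [c = 2]), so [e = 0]. The values 5 and 13 found for [c = 2] come from [3 + 5 = 8] and
    [3 + 13 = 16]. *)
Lemma exp3_pair_scale4 (e i Y N : nat) :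
  (4 * 3 ^ e.+1 + 4 * Y = 4 * N)%N ->
  (`|((4 * 3 ^ e.+1)%N%:Z - 3 * N%:Z)%R| = 3 ^ i.+1)%N ->
  (`|((4 * 3 ^ e.+1)%N%:Z - N%:Z)%R| = 1)%N -> (Y = 10)%N.
Proof.
have := exp3_mod3 i; have := exp3_mod3 e; rewrite !(expnS 3).
have : (0 < 3 ^ e)%N by rewrite expn_gt0.
have : (e == 0)%N -> (3 ^ e = 1)%N by move/eqP->.
have : (i == 0)%N -> (3 ^ i = 1)%N by move/eqP->.
by move: (3 ^ e)%N (3 ^ i)%N (e == 0)%N (i == 0)%N => X Z [] []; lia.
Qed.

Lemma exp3_pair_scale1 (e i Y N : nat) :
  (3 ^ e.+1 + Y = 4 * N)%N ->
  (`|((3 ^ e.+1)%N%:Z - 3 * N%:Z)%R| = 3 ^ i.+1)%N ->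
  (`|((3 ^ e.+1)%N%:Z - N%:Z)%R| = 1)%N -> (Y = 5 \/ Y = 13)%N.
Proof.
have := exp3_mod3 i; have := exp3_mod3 e; rewrite !(expnS 3).
have : (0 < 3 ^ e)%N by rewrite expn_gt0.
have : (e == 0)%N -> (3 ^ e = 1)%N by move/eqP->.
have : (i == 0)%N -> (3 ^ i = 1)%N by move/eqP->.
by move: (3 ^ e)%N (3 ^ i)%N (e == 0)%N (i == 0)%N => X Z [] []; lia.
Qed.

(* A prime [p] dividing both [A] and a Lucas quotient divides its index, so the
   quotient of index [p] is already a power of [p], in fact [p] itself when
   [p > 3]; the norm equation then makes [c ^ t] too small. *)
Lemma vquo_prime_power (p q c e f t k l m i j : nat) :
  prime p -> prime q -> prime c -> p <> q -> p <> c -> q <> c ->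
  scale_ok k l c -> (0 < e)%N -> (0 < f)%N -> (0 < t)%N ->
  (p ^ e + q ^ f = l ^ 2 * c ^ t)%N ->
  `|vquo (k * p ^ e)%N%:Z (c ^ t)%N%:Z m|%N = (p ^ i)%N ->
  `|uquo (k * p ^ e)%N%:Z (c ^ t)%N%:Z m|%N = (q ^ j)%N ->
  (0 < i)%N -> (c = 2 /\ (p * q = 15 \/ p * q = 39))%N.
Proof.
move=> p_pr q_pr c_pr pq pc qc scale e0 f0 t0 sum_pq.
set A := (k * p ^ e)%N%:Z; set N := (c ^ t)%N%:Z => vE uE i0.
have sum4 : (k * p ^ e + k * q ^ f = 4 * c ^ t)%N.
  by case: scale sum_pq => -[-> -> _] ?; lia.
have k0 : (0 < k)%N by case: scale => -[_ -> _].
have A'E : 4 * N - A = (k * q ^ f)%N%:Z by rewrite /A /N; lia.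
have A0 : A != 0.
  by rewrite eqz_nat -lt0n muln_gt0 k0 expn_gt0 prime_gt0.
have A'0 : 4 * N - A != 0.
  by rewrite A'E eqz_nat -lt0n muln_gt0 k0 expn_gt0 prime_gt0.
have pA : (p %| A)%Z by rewrite dvdzE /= dvdn_mull // dvdn_exp.
have qA' : (q %| 4 * N - A)%Z by rewrite A'E dvdzE /= dvdn_mull // dvdn_exp.
have pN : ~~ (p %| N)%Z.
  by rewrite dvdzE /= Euclid_dvdX // dvdn_prime2 // t0 andbT; apply/eqP.
have qN : ~~ (q %| N)%Z.
  by rewrite dvdzE /= Euclid_dvdX // dvdn_prime2 // t0 andbT; apply/eqP.
have p_dvd : (p %| m.*2.+1)%N.
  by rewrite -(prime_dvd_vquo m p_pr pA pN) dvdzE vE /= dvdn_exp.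
have p_odd : odd p.
  case: (even_prime p_pr) => // p2; move: p_dvd.
  by rewrite p2 dvdn2 /= odd_double.
set h := p./2; have Ep : h.*2.+1 = p by rewrite -[RHS]odd_double_half p_odd.
have [n mE] : exists n, m = (h + n * h.*2.+1)%N.
  move/dvdnP: p_dvd => [r rE]; rewrite -[in RHS]Ep in rE.
  by exists r./2; exact: odd_factor_half.
have [i' vE'] : exists i', `|vquo A N h|%N = (p ^ i')%N.
  have := vquo_dvd N h n A0; rewrite -mE dvdzE vE.
  by case/(dvdn_pfactor _ _ p_pr) => i' _ ->; exists i'.
have i'0 : (0 < i')%N.
  have : (p %| vquo A N h)%Z by rewrite prime_dvd_vquo // Ep.
  by rewrite dvdzE vE' /= Euclid_dvdX // => /andP[].
(* A factor [q] of this quotient would divide its index [p]. *)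
have uE' : `|uquo A N h|%N = 1%N.
  have [j' uj'] : exists j', `|uquo A N h|%N = (q ^ j')%N.
    have := uquo_dvd h n A'0; rewrite -mE dvdzE uE.
    by case/(dvdn_pfactor _ _ q_pr) => j' _ ->; exists j'.
  case: j' uj' => // j' uj'.
  have : (q %| vquo (4 * N - A) N h)%Z.
    by rewrite dvdzE -absz_uquo uj' /= dvdn_exp.
  rewrite prime_dvd_vquo // Ep dvdn_prime2 // => /eqP qp.
  by case: pq.
have norm : (k * p ^ e * (p ^ i') ^ 2 + k * q ^ f = 4 * (c ^ t) ^ p)%N.
  have := quo_norm A N h; rewrite Ep !sqr_absz vE' uE' A'E mulr1 /A /N.
  by rewrite -rmorphXn -!PoszM -PoszD; case.
case: (ltnP 3 p) => p3.
  have i'1 : i' = 1%N.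
    apply/eqP; rewrite eqn_leq i'0 andbT leqNgt; apply/negP => i'2.
    have := prime_sq_ndvd_vquo p_pr p3 pA pN.
    by rewrite dvdzE vE' /= dvdn_exp2l.
  move: norm; rewrite i'1 expn1 => norm.
  have lt_sz : ((c ^ t) ^ p < p ^ 2 * c ^ t)%N.
    apply: weighted_sum_lt sum4 norm; last by rewrite muln_gt0 k0 expn_gt0 prime_gt0.
    by rewrite -(exp1n 2) ltn_exp2r // prime_gt1.
  have {}lt_sz : ((c ^ t) ^ p.-1 < p ^ 2)%N.
    move: lt_sz; rewrite -{1}(prednK (prime_gt0 p_pr)) expnSr ltn_pmul2r //.
    by rewrite expn_gt0 prime_gt0.
  have p_le : (p <= p ^ e)%N by rewrite -{1}(expn1 p) leq_exp2l // prime_gt1.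
  have q_ge : (0 < q ^ f)%N by rewrite expn_gt0 prime_gt0.
  (* For odd [c], [c ^ t] exceeds [p ^ e], hence [p], and its power [p.-1] is too large. For [c = 2]
     only [2 ^ p.-1] is available, which reaches [p ^ 2] from [p = 7] on; the remaining [p = 5]
     gives [5 + 3 = 8]. *)
  case: scale sum_pq lt_sz => -[-> _ cE] sum_pq lt_sz.
    have pN' : (p <= c ^ t)%N by move: sum_pq p_le q_ge; clear; lia.
    have p2 : (2 <= p.-1)%N by move: p3; clear; lia.
    move: lt_sz; rewrite ltnNge (@leq_trans ((c ^ t) ^ 2)%N) ?leq_exp2r //.
    by apply: leq_pexp2l p2; rewrite expn_gt0 prime_gt0.
  rewrite cE in lt_sz sum_pq *.
  case: (ltnP 6 p) => p6.
    move: lt_sz; rewrite ltnNge (leq_trans (sqr_le_exp2 p6)) //.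
    by rewrite -expnM leq_exp2l // leq_pmull.
  have p5 : p = 5%N.
    have : p = 4%N \/ p = 5%N \/ p = 6%N by move: p3 p6; clear; lia.
    by case=> [p4|[//|p6']]; move: p_odd; rewrite ?p4 ?p6'.
  rewrite p5 in lt_sz sum_pq p_le *; split=> //; left.
  have t1 : t = 1%N.
    apply/eqP; rewrite eqn_leq t0 andbT leqNgt; apply/negP => t2.
    move: lt_sz; rewrite -expnM ltnNge (@leq_trans (2 ^ 8)%N) //.
    by rewrite leq_exp2l // (@leq_mul 2 4).
  have e1 : e = 1%N.
    apply/eqP; rewrite eqn_leq e0 andbT leqNgt; apply/negP => e2.
    have : (5 ^ 2 <= 5 ^ e)%N by rewrite leq_exp2l.
    by move: sum_pq; rewrite t1; clear; lia.
  have q3 : (q ^ f = 3)%N by move: sum_pq; rewrite e1 t1; clear; lia.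
  by rewrite (@prime_of_pow 3 q 1 f).
have p3' : p = 3%N.
  by apply/eqP; rewrite eqn_leq p3; case: (p) p_odd p_pr => // -[|[]].
have hE : h = 1%N by rewrite /h p3'.
move: vE' uE'; rewrite hE vquo1 uquo1 /A /N p3' => vE' uE'.
have [cE [qf|qf]] : c = 2%N /\ (q ^ f = 5 \/ q ^ f = 13)%N.
  rewrite p3' in sum4; case: i' i'0 vE' {norm} => // i' _ vE'.
  case: e e0 sum4 vE' uE' {vE uE A'E A0 A'0 pA qA' pN qN N A sum_pq} => // e _.
  case: scale => -[_ -> cE] sum4 vE' uE'.
    case: (exp3_pair_scale4 sum4 vE' uE') => qf.
    have: (2 %| q ^ f)%N by rewrite qf.
    have: (5 %| q ^ f)%N by rewrite qf.
    by rewrite !Euclid_dvdX // !dvdn_prime2 // => /andP[/eqP <-].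
  by split=> //; rewrite !mul1n in sum4 vE' uE'; exact: exp3_pair_scale1 sum4 vE' uE'.
- by split=> //; left; rewrite (@prime_of_pow 5 q 1 f) // p3'.
- by split=> //; right; rewrite (@prime_of_pow 13 q 1 f) // p3'.
Qed.

Lemma quo_prime_powers (p q c e f t k l m i j : nat) :
  prime p -> prime q -> prime c -> p <> q -> p <> c -> q <> c ->
  scale_ok k l c -> (0 < e)%N -> (0 < f)%N -> (0 < t)%N ->
  (p ^ e + q ^ f = l ^ 2 * c ^ t)%N ->
  `|vquo (k * p ^ e)%N%:Z (c ^ t)%N%:Z m|%N = (p ^ i)%N ->
  `|uquo (k * p ^ e)%N%:Z (c ^ t)%N%:Z m|%N = (q ^ j)%N ->
  m = 0%N \/ (c = 2 /\ (p * q = 15 \/ p * q = 39))%N.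
Proof.
move=> p_pr q_pr c_pr pq pc qc scale e0 f0 t0 sum_pq vE uE.
case: (posnP i) => [i0|i0]; last first.
  by right; exact: (@vquo_prime_power p q c e f t k l m i j).
have A'E : 4 * (c ^ t)%N%:Z - (k * p ^ e)%N%:Z = (k * q ^ f)%N%:Z.
  by case: scale sum_pq => -[-> -> _]; clear; lia.
have AE : 4 * (c ^ t)%N%:Z - (k * q ^ f)%N%:Z = (k * p ^ e)%N%:Z.
  by rewrite -A'E; ring.
case: (posnP j) => [j0|j0]; last first.
  right; rewrite mulnC.
  apply: (@vquo_prime_power q p c f e t k l m j i) => //; try exact: nesym.
  - by rewrite addnC.
  - by rewrite -A'E -absz_uquo.
  - by rewrite absz_uquo AE.
(* Both quotients are units here, so the norm equation reads [N = N ^+ m.*2.+1]. *)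
left; have := quo_norm (k * p ^ e)%N%:Z (c ^ t)%N%:Z m.
rewrite !sqr_absz vE uE i0 j0 !mulr1 addrC subrK => /(mulfI (_ : 4 != 0)) E.
case: m E {vE uE} => // m /(_ isT) E; exfalso.
have : ((c ^ t) ^ 1 < (c ^ t) ^ m.+1.*2.+1)%N.
  by rewrite ltn_exp2l //; rewrite -(expn0 c) ltn_exp2l // prime_gt1.
by move/(congr1 absz): E; rewrite abszX /= => <-; rewrite expn1 ltnn.
Qed.

(** * Descent *)

Section Descent.
Variables (c k l e1 e2 : nat) (P Q : int).
Hypotheses (c_pr : prime c) (scale : scale_ok k l c).
Hypotheses (cP : ~~ (c %| P)%Z) (cQ : ~~ (c %| Q)%Z) (P_gt0 : 0 < P) (Q_gt0 : 0 < Q).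
Hypotheses (co1 : coprime e1 (l * c)) (co2 : coprime e2 (l * c)).

Lemma scale_sq : k%:Z * l%:Z ^+ 2 = 4.
Proof. by case: scale => -[-> -> _]. Qed.

(** Since [c] does not divide [w], it cannot divide both factors when it is odd; for [c = 2] both
    factors are even and the same holds for their halves, whose sum is [w]. So one factor absorbs
    the whole power of [c]. *)
Lemma split_factor (x y w om : int) K :
  x * y = l%:Z ^+ 2 * c%:Z ^+ K * om -> x + y = 2 * w -> ~~ (c %| w)%Z ->
  exists v, (x = l%:Z * c%:Z ^+ K * v \/ y = l%:Z * c%:Z ^+ K * v) /\
            (~~ (c %| om)%Z -> ~~ (c %| v)%Z).
Proof.
have aux (a b : int) : a * b = c%:Z ^+ K * om -> ~~ (c %| a)%Z ->
    exists v, b = c%:Z ^+ K * v /\ (~~ (c %| om)%Z -> ~~ (c %| v)%Z).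
  move=> E ca; have : (c%:Z ^+ K %| b)%Z.
    have : (c%:Z ^+ K %| a * b)%Z by rewrite E dvdz_mulr.
    rewrite Gauss_dvdzr // coprimezE abszX /=.
    by rewrite coprimeXl // prime_coprime.
  case/dvdzP => v vE; exists v; split; first by rewrite vE mulrC.
  apply: contraNN => cv; rewrite vE mulrCA mulrA in E.
  have cK0 : c%:Z ^+ K != 0 by rewrite expf_neq0 // eqz_nat -lt0n prime_gt0.
  have -> : om = a * v by apply: (mulfI cK0); rewrite -E; ring.
  by rewrite dvdz_mull.
case: scale => -[lE _ cE] E sumE cw; rewrite lE in E *.
  rewrite expr1n mul1r in E; rewrite mul1r.
  case: (boolP (c %| x)%Z) => cx; last first.
    by have [v [-> ?]] := aux _ _ E cx; exists v; split=> //; right.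
  have cy : ~~ (c %| y)%Z.
    apply: contraNN cw => cy; have : (c %| 2 * w)%Z by rewrite -sumE rpredD.
    rewrite Euclid_dvdzM // => /orP[|//]; rewrite dvdzE /= => c2.
    by move: cE; rewrite (eqP (_ : c == 2)) // -dvdn_prime2.
  by rewrite mulrC in E; have [v [-> ?]] := aux _ _ E cy; exists v; split=> //; left.
have two_even (z : int) : (2 %| z)%Z -> exists z', z = 2 * z'.
  by case/dvdzP => z' ->; exists z'; rewrite mulrC.
have x_even : (2 %| x)%Z.
  have : (2%N %| x * y)%Z.
    by rewrite E -[(2%N%:Z ^+ 2)]/(2 * 2 : int) -!mulrA dvdz_mulr.
  rewrite Euclid_dvdzM // => /orP[//|y2].
  have -> : x = 2 * w - y by rewrite -sumE addrK.
  by rewrite rpredB // dvdz_mulr.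
have y_even : (2 %| y)%Z.
  have -> : y = 2 * w - x by rewrite -sumE addrC addKr.
  by rewrite rpredB // dvdz_mulr.
have [x1 xE] := two_even _ x_even; have [y1 yE] := two_even _ y_even.
have {}E : x1 * y1 = c%:Z ^+ K * om.
  apply: (@mulfI _ (4 : int)) => //; transitivity (x * y); first by rewrite xE yE; ring.
  by rewrite E -[(2%N%:Z ^+ 2)]/(4 : int) mulrA.
have {}sumE : x1 + y1 = w by apply: (@mulfI _ (2 : int)) => //; rewrite -sumE xE yE; ring.
case: (boolP (c %| x1)%Z) => cx.
  have cy : ~~ (c %| y1)%Z by apply: contraNN cw => cy; rewrite -sumE rpredD.
  rewrite mulrC in E; have [v [vE ?]] := aux _ _ E cy; exists v; split=> //; left.
  by rewrite xE vE mulrA.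
have [v [vE ?]] := aux _ _ E cx; exists v; split=> //; right.
by rewrite yE vE mulrA.
Qed.

Lemma dvdz_of_sq (x w : int) M :
  P * w ^+ 2 = (l%:Z * c%:Z ^+ M) ^+ 2 * x -> (l%:Z * c%:Z ^+ M %| w)%Z.
Proof.
move=> E; have : ((l%:Z * c%:Z ^+ M) ^+ 2 %| P * w ^+ 2)%Z by rewrite E dvdz_mulr.
rewrite Gauss_dvdzr; last first.
  rewrite coprimezE abszX coprime_pexpl // abszM abszX /= coprimeMl.
  have cop : coprime c `|P|%N by rewrite prime_coprime.
  apply/andP; split; last exact: coprimeXl.
  by case: scale => -[-> _ cE]; rewrite ?coprime1n // -cE.
by rewrite !dvdzE !abszX dvdn_pexp2r.
Qed.

(* The number [(u sqrt P + v sqrt (- Q)) / l] has norm [c ^ n] and is not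
   divisible by [c].  The divisors [e1] and [e2] survive the descent; they are
   chosen to keep the primes [p] and [q] in the two parts of the norm. *)
Definition is_rep n (u v : int) :=
  [/\ P * u ^+ 2 + Q * v ^+ 2 = l%:Z ^+ 2 * c%:Z ^+ n, ~~ (c %| u)%Z,
      ~~ (c %| v)%Z, (e1 %| u)%Z & (e2 %| v)%Z].

Lemma c_neq0 M : c%:Z ^+ M != 0.
Proof. by rewrite expf_neq0 // eqz_nat -lt0n prime_gt0. Qed.

Lemma l_neq0 : l%:Z != 0.
Proof. by case: scale => -[-> _ _]. Qed.

(* Of the products with [(r + s sqrt (- P Q)) / l] and with its conjugate, one is
   divisible by the smaller of the two powers of [c]. *)
Lemma twist n K (u v r s : int) :
  is_rep n u v -> r ^+ 2 + P * Q * s ^+ 2 = l%:Z ^+ 2 * c%:Z ^+ K ->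
  ~~ (c %| r)%Z -> ~~ (c %| s)%Z -> (e1 %| s)%Z -> (e2 %| s)%Z ->
  let M := minn n K in
  exists sg u' v', [/\ sg = 1 \/ sg = -1,
     l%:Z * c%:Z ^+ M * u' = u * r - sg * Q * v * s,
     l%:Z * c%:Z ^+ M * v' = v * r + sg * P * u * s &
     [/\ P * u' ^+ 2 + Q * v' ^+ 2 = l%:Z ^+ 2 * c%:Z ^+ (n + K - M - M),
       n <> K -> ~~ (c %| u')%Z, n <> K -> ~~ (c %| v')%Z,
       (e1 %| u')%Z & (e2 %| v')%Z]].
Proof.
case=> uvE cu cv eu ev rsE cr cs e1s e2s M.
have [Mn MK] : (M <= n)%N /\ (M <= K)%N by rewrite geq_minl geq_minr.
have cnE : c%:Z ^+ n = c%:Z ^+ M * c%:Z ^+ (n - M) by rewrite -exprD subnKC.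
have cKE : c%:Z ^+ K = c%:Z ^+ M * c%:Z ^+ (K - M) by rewrite -exprD subnKC.
pose om := v ^+ 2 * c%:Z ^+ (K - M) - P * s ^+ 2 * c%:Z ^+ (n - M).
have prodE : (v * r + P * u * s) * (v * r - P * u * s) = l%:Z ^+ 2 * c%:Z ^+ M * om.
  transitivity (v ^+ 2 * (r ^+ 2 + P * Q * s ^+ 2)
    - P * s ^+ 2 * (P * u ^+ 2 + Q * v ^+ 2)); first by ring.
  by rewrite rsE uvE cnE cKE /om; ring.
have cvr : ~~ (c %| v * r)%Z by rewrite Euclid_dvdzM // negb_or cv.
(* For [n <> K] exactly one of the two terms of [om] keeps a positive power of [c]. *)
have c_om : n <> K -> ~~ (c %| om)%Z.
  move=> nK; have cPs : ~~ (c %| P * s ^+ 2)%Z.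
    by rewrite Euclid_dvdzM // Euclid_dvdzX // negb_or cP negb_and cs.
  have cv2 : ~~ (c %| v ^+ 2)%Z by rewrite Euclid_dvdzX // negb_and cv.
  have cS i (x : int) : (c %| x * c%:Z ^+ i.+1)%Z.
    by rewrite dvdz_mull // exprS dvdz_mulr.
  case: (ltngtP n K) => // ltnK; rewrite /om /M.
  - have -> : (n - minn n K = 0)%N by move: ltnK; clear; lia.
    have -> : (K - minn n K = (K - n).-1.+1)%N by move: ltnK; clear; lia.
    by rewrite expr0 mulr1 rpredBl.
  - have -> : (K - minn n K = 0)%N by move: ltnK; clear; lia.
    have -> : (n - minn n K = (n - K).-1.+1)%N by move: ltnK; clear; lia.
    by rewrite expr0 mulr1 rpredBr.
have [||v' [vE cv']] := split_factor prodE (_ : _ = 2 * (v * r)) => //; first by ring.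
have [sg [sgE {}vE]] : exists sg : int, (sg = 1 \/ sg = -1) /\
    l%:Z * c%:Z ^+ M * v' = v * r + sg * P * u * s.
  case: vE => <-; [exists 1|exists (-1)]; split; by [left|right|ring].
have sg2 : sg ^+ 2 = 1 by case: sgE => ->.
have normE : P * (u * r - sg * Q * v * s) ^+ 2 + Q * (l%:Z * c%:Z ^+ M * v') ^+ 2 =
    (l%:Z * c%:Z ^+ M) ^+ 2 * (l%:Z ^+ 2 * c%:Z ^+ (n - M) * c%:Z ^+ (K - M)).
  rewrite vE.
  transitivity ((P * u ^+ 2 + Q * v ^+ 2) * (r ^+ 2 + sg ^+ 2 * P * Q * s ^+ 2)).
    by ring.
  by rewrite sg2 mul1r rsE uvE cnE cKE; ring.
(* Multiplicativity of the norm carries the divisibility of the second coordinate over to the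
   first. *)
have : (l%:Z * c%:Z ^+ M %| u * r - sg * Q * v * s)%Z.
  apply: (@dvdz_of_sq (l%:Z ^+ 2 * c%:Z ^+ (n - M) * c%:Z ^+ (K - M) - Q * v' ^+ 2)).
  by rewrite mulrBr -normE; ring.
case/dvdzP => u'; rewrite [RHS]mulrC => uE.
have lc0 : l%:Z * c%:Z ^+ M != 0 by rewrite mulf_neq0 ?l_neq0 ?c_neq0.
have newE : P * u' ^+ 2 + Q * v' ^+ 2 = l%:Z ^+ 2 * c%:Z ^+ (n + K - M - M).
  have -> : (n + K - M - M = (n - M) + (K - M))%N by move: Mn MK; clear; lia.
  apply: (mulfI (expf_neq0 2 lc0)); rewrite exprD mulrA.
  rewrite -normE uE; ring.
exists sg, u', v'; split=> //; split=> //.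
- move=> nK; apply: contraNN (cv' (c_om nK)) => cu'.
  have : (c %| Q * v' ^+ 2)%Z.
    have -> : Q * v' ^+ 2 = l%:Z ^+ 2 * c%:Z ^+ (n + K - M - M) - P * u' ^+ 2.
      by rewrite -newE; ring.
    rewrite rpredB //; last by rewrite dvdz_mull // Euclid_dvdzX // cu'.
    have -> : (n + K - M - M = (n + K - M - M).-1.+1)%N.
      by move: nK; rewrite /M; clear; lia.
    by rewrite dvdz_mull // exprS dvdz_mulr.
  by rewrite Euclid_dvdzM // Euclid_dvdzX // (negbTE cQ) andbT.
- by move=> nK; apply: cv' (c_om nK).
- have : (e1 %| l%:Z * c%:Z ^+ M * u')%Z.
    by rewrite -uE rpredB //; [rewrite dvdz_mulr | rewrite dvdz_mull].
  rewrite Gauss_dvdzr // coprimezE abszM abszX /=.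
  by move: co1; rewrite !coprimeMr => /andP[-> ?]; rewrite coprimeXr.
- have : (e2 %| l%:Z * c%:Z ^+ M * v')%Z.
    by rewrite vE rpredD //; [rewrite dvdz_mulr | rewrite dvdz_mull].
  rewrite Gauss_dvdzr // coprimezE abszM abszX /=.
  by move: co2; rewrite !coprimeMr => /andP[-> ?]; rewrite coprimeXr.
Qed.


Hypothesis base_ok :
  l%:Z ^+ 2 < P * Q \/ [/\ l = 1%N, P = 1, Q = 1 & (1 < e1)%N].

Lemma sqr_eq_sign (x y : int) :
  x ^+ 2 = y ^+ 2 -> exists d : int, (d = 1 \/ d = -1) /\ x = d * y.
Proof.
move/eqP; rewrite eqf_sqr => /orP[] /eqP ->.
  by exists 1; split; [left | rewrite mul1r].
by exists (-1); split; [right | rewrite mulN1r].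
Qed.

(** After conjugating one element if necessary, the quotient of the two has norm 1 and [s / l] as
    coefficient of [sqrt (- P Q)], so [P * Q * s ^+ 2 <= l ^+ 2]. By [base_ok] this means [s = 0],
    except for [P = Q = 1], where a Gaussian unit could exchange the coordinates; then [e1] would
    divide [c ^ t]. *)
Lemma rep_unique t (u v u0 v0 : int) : is_rep t u v -> is_rep t u0 v0 ->
  exists d1 d2 : int, [/\ d1 = 1 \/ d1 = -1, d2 = 1 \/ d2 = -1,
                         u = d1 * u0 & v = d2 * v0].
Proof.
case=> uvE cu cv eu ev [uvE0 cu0 cv0 eu0 ev0].
have lc0 : l%:Z ^+ 2 * c%:Z ^+ t != 0 by rewrite mulf_neq0 ?c_neq0 // expf_neq0 // l_neq0.
suff [u2 v2] : u ^+ 2 = u0 ^+ 2 /\ v ^+ 2 = v0 ^+ 2.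
  have [d1 [? ?]] := sqr_eq_sign u2; have [d2 [? ?]] := sqr_eq_sign v2.
  by exists d1, d2.
have prodE : P * ((u * v0 + u0 * v) * (u * v0 - u0 * v)) =
    l%:Z ^+ 2 * c%:Z ^+ t * (v0 ^+ 2 - v ^+ 2).
  transitivity (v0 ^+ 2 * (P * u ^+ 2 + Q * v ^+ 2) -
    v ^+ 2 * (P * u0 ^+ 2 + Q * v0 ^+ 2)); first by ring.
  by rewrite uvE uvE0; ring.
have [om omE] : exists om, (u * v0 + u0 * v) * (u * v0 - u0 * v) =
    l%:Z ^+ 2 * c%:Z ^+ t * om.
  have : (l%:Z ^+ 2 * c%:Z ^+ t %| P * ((u * v0 + u0 * v) * (u * v0 - u0 * v)))%Z.
    by rewrite prodE dvdz_mulr.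
  rewrite Gauss_dvdzr; first by case/dvdzP => om ->; exists om; rewrite mulrC.
  have cop : coprime c `|P|%N by rewrite prime_coprime.
  rewrite coprimezE abszM !abszX /= coprimeMl coprimeXl //= ?coprimeXl //.
  by case: scale => -[-> _ cE]; rewrite ?coprime1n // -cE.
have [||s [sE _]] := split_factor omE (_ : _ = 2 * (u * v0)); first by ring.
  by rewrite Euclid_dvdzM // negb_or cu.
have [sg [sgE {}sE]] : exists sg : int, (sg = 1 \/ sg = -1) /\
    u * v0 + sg * u0 * v = l%:Z * c%:Z ^+ t * s.
  by case: sE => <-; [exists 1|exists (-1)]; split; by [left|right|ring].
have sg2 : sg ^+ 2 = 1 by case: sgE => ->.
have normE : (P * u * u0 - sg * Q * v * v0) ^+ 2 =
    (l%:Z * c%:Z ^+ t) ^+ 2 * (l%:Z ^+ 2 - P * Q * s ^+ 2).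
  transitivity ((P * u ^+ 2 + Q * v ^+ 2) * (P * u0 ^+ 2 + Q * v0 ^+ 2) -
    P * Q * (u * v0 + sg * u0 * v) ^+ 2 +
    (sg ^+ 2 - 1) * (Q ^+ 2 * v ^+ 2 * v0 ^+ 2 + P * Q * u0 ^+ 2 * v ^+ 2)).
    by ring.
  by rewrite sg2 subrr mul0r addr0 uvE uvE0 sE; ring.
have s_le : P * Q * s ^+ 2 <= l%:Z ^+ 2.
  rewrite -subr_ge0 -(pmulr_rge0 _ (_ : 0 < (l%:Z * c%:Z ^+ t) ^+ 2)).
    by rewrite -normE sqr_ge0.
  by rewrite lt0r sqr_ge0 andbT expf_neq0 // mulf_neq0 ?l_neq0 ?c_neq0.
have s0_case : s = 0 -> u ^+ 2 = u0 ^+ 2 /\ v ^+ 2 = v0 ^+ 2.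
  move=> s0; rewrite s0 mulr0 in sE.
  have {sE} E : u ^+ 2 * v0 ^+ 2 = u0 ^+ 2 * v ^+ 2.
    have E' : u * v0 = - (sg * u0 * v) by apply/eqP; rewrite -addr_eq0 sE.
    by rewrite -exprMn E' -[RHS]mul1r -sg2; ring.
  split; apply: (mulfI lc0).
  - transitivity (P * u0 ^+ 2 * u ^+ 2 + Q * (u ^+ 2 * v0 ^+ 2)).
      by rewrite -uvE0; ring.
    by rewrite E -uvE; ring.
  - transitivity (P * (u0 ^+ 2 * v ^+ 2) + Q * v0 ^+ 2 * v ^+ 2).
      by rewrite -uvE0; ring.
    by rewrite -E -uvE; ring.
have [s_eq0|s0] := eqVneq s 0; first exact: s0_case.
have s1 : 1 <= s ^+ 2 by rewrite -gtz0_ge1 lt0r sqr_ge0 expf_neq0.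
case: base_ok => [lt_PQ|[lE PE QE e1_gt1]].
  have PQ0 : 0 < P * Q by rewrite mulr_gt0.
  have := le_lt_trans s_le lt_PQ; rewrite gtr_pMr // ltNge s1.
  by [].
exfalso; rewrite PE QE lE !mul1r ?expr1n in s_le uvE uvE0 normE.
have s2 : s ^+ 2 = 1 by apply/eqP; rewrite eq_le s_le s1.
move: normE; rewrite s2 subrr mulr0 => /eqP; rewrite sqrf_eq0 subr_eq0 mulr1 => /eqP E.
have : u ^+ 2 = v0 ^+ 2.
  have {}E : u ^+ 2 * u0 ^+ 2 = v ^+ 2 * v0 ^+ 2.
    by rewrite -exprMn E -[RHS]mul1r -sg2; ring.
  apply: (mulfI (c_neq0 t)).
  transitivity (u ^+ 2 * u0 ^+ 2 + u ^+ 2 * v0 ^+ 2); first by rewrite -uvE0; ring.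
  by rewrite E -uvE; ring.
move=> uv0; have : (e1 %| c%:Z ^+ t)%Z.
  by rewrite -uvE0 -uv0 !expr2 rpredD // dvdz_mulr.
move: co1; rewrite coprimeMr dvdzE abszX /= => /andP[_ co_ec].
have co_et : coprime e1 (c ^ t) by rewrite coprimeXr.
move=> e1_dvd; move: co_et; rewrite /coprime (gcdn_idPl e1_dvd) => /eqP e1E.
by move: e1_gt1; rewrite e1E.
Qed.

Variables (t : nat) (u0 v0 : int).
Hypotheses (t_gt0 : (0 < t)%N) (rep0 : is_rep t u0 v0).
Hypothesis minimal : forall n u v, (0 < n < t)%N -> ~ is_rep n u v.

(** For [g = (u0 sqrt P + v0 sqrt (- Q)) / l] and its conjugate [h], these are [(g + h) ^ 2] and
    [g * h], the arguments of the Lucas quotients. *)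
Let A : int := k%:Z * P * u0 ^+ 2.
Let N : int := c%:Z ^+ t.

Lemma conorm : 4 * N - A = k%:Z * Q * v0 ^+ 2.
Proof.
have [uvE _ _ _ _] := rep0.
transitivity (k%:Z * (P * u0 ^+ 2 + Q * v0 ^+ 2) - A); last by rewrite /A; ring.
by rewrite uvE mulrA scale_sq.
Qed.

(** [(r + s sqrt (- P Q)) / l] is the square of the minimal element; it is the multiplier used in
    every descent step. *)
Lemma square_rep : exists r s : int,
  [/\ l%:Z * r = P * u0 ^+ 2 - Q * v0 ^+ 2, l%:Z * s = 2 * u0 * v0,
      ~~ (c %| r)%Z, ~~ (c %| s)%Z & (e1 %| s)%Z /\ (e2 %| s)%Z].
Proof.
have [uvE cu cv eu ev] := rep0.
have cuv : (c %| u0 * v0)%Z = false by rewrite Euclid_dvdzM // (negbTE cu) (negbTE cv).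
have cQv : (c %| Q * v0 ^+ 2)%Z = false.
  by rewrite Euclid_dvdzM // Euclid_dvdzX // (negbTE cQ) (negbTE cv).
have ct : (c %| c%:Z ^+ t)%Z by rewrite -(prednK t_gt0) exprS dvdz_mulr.
case: scale uvE => -[-> _ cE] uvE.
- have c2 : (c %| 2)%Z = false.
    rewrite dvdzE /= dvdn_prime2 //; apply/eqP => c2.
    by rewrite c2 in cE.
  exists (P * u0 ^+ 2 - Q * v0 ^+ 2), (2 * u0 * v0); rewrite !mul1r; split=> //.
  + have -> : P * u0 ^+ 2 - Q * v0 ^+ 2 = c%:Z ^+ t - 2 * (Q * v0 ^+ 2).
      by rewrite -[c%:Z ^+ t]mul1r -[1 in X in _ = X - _](expr1n _ 2) -uvE; ring.
    by rewrite rpredBl // Euclid_dvdzM // c2 cQv.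
  + by rewrite -mulrA Euclid_dvdzM // c2 cuv.
  + by split; [rewrite dvdz_mulr // dvdz_mull | rewrite dvdz_mull].
- exists (2 * c%:Z ^+ t - Q * v0 ^+ 2), (u0 * v0); split=> //.
  + transitivity (2%N%:Z ^+ 2 * c%:Z ^+ t - 2 * (Q * v0 ^+ 2)); first by ring.
    by rewrite -uvE; ring.
  + by rewrite -mulrA.
  + by rewrite rpredBl ?cQv // dvdz_mull.
  + by rewrite cuv.
  + by split; [rewrite dvdz_mulr | rewrite dvdz_mull].
Qed.

(** Twisting by the square of the minimal element turns the exponent [n] into the distance between
    [n] and [2 t]. For [t < n < 2 t] this contradicts minimality, for [n > 2 t] the induction
    applies, and [n = 2 t] would end at norm 1, which the last hypothesis excludes by assumption or
    by parity. *)
Theorem descent n (u v : int) : (0 < n)%N -> is_rep n u v ->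
  (forall x y, (e1 %| x)%Z -> (e2 %| y)%Z ->
     P * x ^+ 2 + Q * y ^+ 2 <> l%:Z ^+ 2) \/ odd n /\ odd t ->
  exists m (d1 d2 : int), [/\ d1 = 1 \/ d1 = -1, d2 = 1 \/ d2 = -1,
    n = (m.*2.+1 * t)%N, u = d1 * u0 * vquo A N m & v = d2 * v0 * uquo A N m].
Proof.
elim/ltn_ind: n u v => n IHn u v n_gt0 rep_n endc.
case: (ltngtP n t) => [n_lt|n_gt|nE].
- by case: (@minimal n u v); rewrite ?n_gt0.
- have [r [s [rE sE cr cs [e1s e2s]]]] := square_rep.
  have rsE : r ^+ 2 + P * Q * s ^+ 2 = l%:Z ^+ 2 * c%:Z ^+ t.*2.
    apply: (mulfI (expf_neq0 2 l_neq0)).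
    transitivity ((l%:Z * r) ^+ 2 + P * Q * (l%:Z * s) ^+ 2); first by ring.
    have [uvE0 _ _ _ _] := rep0.
    rewrite rE sE -addnn exprD.
    transitivity ((P * u0 ^+ 2 + Q * v0 ^+ 2) ^+ 2); first by ring.
    by rewrite uvE0; ring.
  have [sg [u' [v' [sgE uE vE [newE cu' cv' e1u' e2v']]]]] :=
    twist rep_n rsE cr cs e1s e2s.
  have rep' : n <> t.*2 -> is_rep (n + t.*2 - minn n t.*2 - minn n t.*2) u' v'.
    by move=> nt; split=> //; [apply: cu' | apply: cv'].
  case: (ltngtP n t.*2) => [n_lt|n_gt2|nE].
  + case: (minimal _ (rep' _)); last by move: n_lt; clear; lia.
    by move: n_gt n_lt; clear; lia.
  + have nE : (n + t.*2 - minn n t.*2 - minn n t.*2 = n - t.*2)%N.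
      by move: n_gt2; clear; lia.
    have {}rep' := rep' (_ : n <> t.*2); rewrite nE in rep' newE.
    have ME : minn n t.*2 = t.*2 by move: n_gt2; clear; lia.
    rewrite ME in uE vE.
    have [||||m [d1 [d2 [d1E d2E mE u'E v'E]]]] := IHn (n - t.*2)%N _ u' v'.
    * by move: n_gt2 t_gt0; clear; lia.
    * by move: n_gt2; clear; lia.
    * by apply: rep'; move: n_gt2; clear; lia.
    * case: endc => [|[n_odd t_odd]]; [by left | right].
      by rewrite oddB ?odd_double ?addbF // ltnW.
    have lcK0 : l%:Z * c%:Z ^+ t.*2 != 0 by rewrite mulf_neq0 ?l_neq0 ?c_neq0.
    have sg2 : sg ^+ 2 = 1 by case: sgE => ->.
    have luE : l%:Z * u = u' * r + sg * Q * v' * s.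
      apply: (mulfI lcK0).
      transitivity ((l%:Z * c%:Z ^+ t.*2 * u') * r +
        sg * Q * (l%:Z * c%:Z ^+ t.*2 * v') * s); last by ring.
      rewrite uE vE.
      transitivity (u * (r ^+ 2 + sg ^+ 2 * P * Q * s ^+ 2)); last by ring.
      by rewrite sg2 mul1r rsE; ring.
    have lvE : l%:Z * v = v' * r - sg * P * u' * s.
      apply: (mulfI lcK0).
      transitivity ((l%:Z * c%:Z ^+ t.*2 * v') * r -
        sg * P * (l%:Z * c%:Z ^+ t.*2 * u') * s); last by ring.
      rewrite uE vE.
      transitivity (v * (r ^+ 2 + sg ^+ 2 * P * Q * s ^+ 2)); last by ring.
      by rewrite sg2 mul1r rsE; ring.
    have TE : k%:Z * (P * u0 ^+ 2 - Q * v0 ^+ 2) = 2 * (A - 2 * N).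
      transitivity (A - (4 * N - A)); last by ring.
      by rewrite conorm /A; ring.
    have u2E : 2 * u = u0 * (d1 * (A - 2 * N) * vquo A N m +
        sg * d2 * (4 * N - A) * uquo A N m).
      apply: (@mulfI _ (2 : int)) => //.
      transitivity (k%:Z * l%:Z ^+ 2 * u); first by rewrite scale_sq; ring.
      transitivity (k%:Z * (l%:Z * (l%:Z * u))); first by ring.
      rewrite luE.
      transitivity (k%:Z * (u' * (l%:Z * r) + sg * Q * v' * (l%:Z * s))); first by ring.
      rewrite rE sE u'E v'E.
      transitivity (u0 * (d1 * (k%:Z * (P * u0 ^+ 2 - Q * v0 ^+ 2)) * vquo A N m +
         2 * sg * d2 * (k%:Z * Q * v0 ^+ 2) * uquo A N m)); first by ring.
      by rewrite TE -conorm; ring.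
    have v2E : 2 * v = v0 * (d2 * (A - 2 * N) * uquo A N m -
        sg * d1 * A * vquo A N m).
      apply: (@mulfI _ (2 : int)) => //.
      transitivity (k%:Z * l%:Z ^+ 2 * v); first by rewrite scale_sq; ring.
      transitivity (k%:Z * (l%:Z * (l%:Z * v))); first by ring.
      rewrite lvE.
      transitivity (k%:Z * (v' * (l%:Z * r) - sg * P * u' * (l%:Z * s))); first by ring.
      rewrite rE sE u'E v'E.
      transitivity (v0 * (d2 * (k%:Z * (P * u0 ^+ 2 - Q * v0 ^+ 2)) * uquo A N m -
         2 * sg * d1 * (k%:Z * P * u0 ^+ 2) * vquo A N m)); first by ring.
      by rewrite TE /A; ring.
    (* Undoing the twist multiplies the odd power by [g ^ 2] or by [h ^ 2]. The first continues the
       sequence of powers; the second makes [u] divisible by [N], hence by [c]. *)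
    have [sgd|sgd] : sg * d2 = - d1 \/ sg * d2 = d1.
      by case: sgE d1E d2E => -> [] -> [] ->; [right|left|left|right|left|right|right|left].
    * have sgd' : sg * d1 = - d2.
        by rewrite -[d1]opprK -sgd mulrN mulrA -expr2 sg2 mul1r.
      have [Sv Su] := quo_step A N m.
      exists m.+1, d1, d2; split=> //.
      - by move: mE n_gt2; clear; rewrite doubleS; lia.
      - apply: (@mulfI _ (2 : int)) => //; rewrite u2E sgd.
        transitivity (d1 * u0 * (2 * vquo A N m.+1)); last by ring.
        by rewrite Sv; ring.
      - apply: (@mulfI _ (2 : int)) => //; rewrite v2E sgd'.
        transitivity (d2 * v0 * (2 * uquo A N m.+1)); last by ring.
        by rewrite Su; ring.
    * exfalso; have [_ cu _ _ _] := rep_n; apply: (negP cu); rewrite sgd in u2E.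
      have cN (x : int) : (c %| N * x)%Z.
        by rewrite dvdz_mulr // /N -(prednK t_gt0) exprS dvdz_mulr.
      case: m {mE u'E v'E v2E} u2E => [|m] u2E.
        have -> : u = N * (u0 * d1); last exact: cN.
        by apply: (@mulfI _ (2 : int)) => //; rewrite u2E vquo0 uquo0; ring.
      have -> : u = N * (N * u0 * d1 * vquo A N m); last exact: cN.
      apply: (@mulfI _ (2 : int)) => //; rewrite u2E.
      transitivity (u0 * d1 * ((A - 2 * N) * vquo A N m.+1 +
        (4 * N - A) * uquo A N m.+1)); first by ring.
      by rewrite quo_back; ring.
  + exfalso; case: endc => [noend|[]]; last by rewrite nE odd_double.
    apply: (noend u' v') => //; rewrite newE nE minnn.
    by rewrite (_ : (_ - _)%N = 0%N) ?mulr1 //; clear; lia.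
- rewrite nE in rep_n; have [d1 [d2 [? ? uE vE]]] := rep_unique rep_n rep0.
  exists 0%N, d1, d2; split=> //; last 2 first.
  + by rewrite vquo0 mulr1.
  + by rewrite uquo0 mulr1.
  + by rewrite mul1n.
Qed.

End Descent.

(** * Uniqueness in a parity class *)

Lemma ex_minimal (P : nat -> Prop) :
  (exists n, P n) -> exists n, P n /\ forall m, (m < n)%N -> ~ P m.
Proof.
case=> n; elim/ltn_ind: n => n IHn Pn.
case: (classic (exists2 m, (m < n)%N & P m)) => [[m mn Pm]|noP].
  exact: IHn mn Pm.
by exists n; split=> // m mn Pm; apply: noP; exists m.
Qed.

Definition scale_k c : nat := if c == 2%N then 1%N else 4%N.
Definition scale_l c : nat := if c == 2%N then 2%N else 1%N.
(** The exponent of the norm once the denominator is split off: [2 ^ z = 2 ^ 2 * 2 ^ (z - 2)].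
    Solutions with [c = 2] have [z >= 3], so nothing is truncated. *)
Definition shift_exp c z : nat := if c == 2%N then (z - 2)%N else z.
Definition radical_part p x : nat := (p ^ odd x)%N.

Lemma prime_scale_ok c : prime c -> scale_ok (scale_k c) (scale_l c) c.
Proof.
move=> c_pr; rewrite /scale_k /scale_l; case: eqP => [->|c2]; [by right|left].
by split=> //; case: (even_prime c_pr).
Qed.

Lemma odd_part_pow p x : (radical_part p x * (p ^ x./2) ^ 2 = p ^ x)%N.
Proof.
by rewrite /radical_part -expnM -expnD muln2 odd_double_half.
Qed.

Lemma expn_even_mod8 p n : odd p -> ((p ^ n.*2) %% 8 = 1)%N.
Proof.
move=> p_odd; rewrite -mul2n expnM -modnXm.
have -> : ((p ^ 2) %% 8 = 1)%N.
  rewrite -modnXm; move: p_odd; rewrite {1}(divn_eq p 8) oddD oddM andbF /=.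
  have : (p %% 8 < 8)%N by rewrite ltn_mod.
  by move: (p %% 8)%N; do 8![case=> //].
by rewrite exp1n.
Qed.

Section ParityClass.
Variables p q c : nat.
Hypotheses (p_pr : prime p) (q_pr : prime q) (c_pr : prime c).
Hypotheses (pq : p <> q) (pc : p <> c) (qc : q <> c).
Hypothesis regular : ~ (c = 2 /\ (p * q = 15 \/ p * q = 39))%N.

Lemma exp2_ge8 x y z : c = 2%N -> (0 < x)%N -> (0 < y)%N ->
  (p ^ x + q ^ y = c ^ z)%N -> (3 <= z)%N.
Proof.
move=> c2 x0 y0 E; rewrite c2 in E.
have [_ p3] : odd p /\ (3 <= p)%N by apply: odd_prime_ge3; rewrite -?c2.
have [_ q3] : odd q /\ (3 <= q)%N by apply: odd_prime_ge3; rewrite -?c2.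
have px : (p <= p ^ x)%N by rewrite -{1}(expn1 p) leq_exp2l // prime_gt1.
have qy : (q <= q ^ y)%N by rewrite -{1}(expn1 q) leq_exp2l // prime_gt1.
rewrite ltnNge; apply/negP => z2.
have : (2 ^ z <= 2 ^ 2)%N by rewrite leq_exp2l.
by move: p3 q3 px qy E; clear; lia.
Qed.

Lemma shift_expE x y z : (0 < x)%N -> (0 < y)%N -> (0 < z)%N ->
  (p ^ x + q ^ y = c ^ z)%N ->
  (0 < shift_exp c z /\ scale_l c ^ 2 * c ^ shift_exp c z = c ^ z)%N.
Proof.
move=> x0 y0 z0 E; rewrite /shift_exp /scale_l; case: eqP => [c2|_]; last by rewrite mul1n.
have z3 := exp2_ge8 c2 x0 y0 E; split; first by move: z3; clear; lia.
by rewrite c2 -expnD subnKC // ltnW.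
Qed.

Section OneClass.
Variables ox oy : bool.
Let P := (p ^ ox)%N.
Let Q := (q ^ oy)%N.
(** An odd exponent leaves [p] in the coefficient [P]; an even one gives [P = 1], and [p] has to be
    forced into [u] instead. *)
Let e1 := if ox then 1%N else p.
Let e2 := if oy then 1%N else q.
Let rep := is_rep c (scale_l c) e1 e2 P%:Z Q%:Z.

Lemma coprime_forced (r : nat) (b : bool) : prime r -> r <> c ->
  coprime (if b then 1%N else r) (scale_l c * c).
Proof.
move=> r_pr rc; case: b; first exact: coprime1n.
have r_c : coprime r c by rewrite prime_coprime // dvdn_prime2 //; apply/eqP.
rewrite coprimeMr r_c andbT /scale_l; case: eqP => [c2|_]; last exact: coprimen1.
by rewrite -c2.
Qed.

Lemma ndvd_pow (r : nat) i : prime r -> r <> c -> ~~ (c %| (r ^ i)%N%:Z)%Z.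
Proof.
move=> r_pr rc; rewrite dvdzE /= Euclid_dvdX // dvdn_prime2 // negb_and.
by apply/orP; left; apply/eqP => cr; apply: rc.
Qed.

Lemma sol_rep x y z : odd x = ox -> odd y = oy ->
  (0 < x)%N -> (0 < y)%N -> (0 < z)%N -> (p ^ x + q ^ y = c ^ z)%N ->
  rep (shift_exp c z) (p ^ x./2)%N%:Z (q ^ y./2)%N%:Z.
Proof.
move=> oxE oyE x0 y0 z0 E; have [_ lE] := shift_expE x0 y0 z0 E.
have forced r i b : odd i = b -> (0 < i)%N ->
    ((if b then 1%N else r) %| (r ^ i./2)%N%:Z)%Z.
  move=> <- i0; case: ifP => // i_ev; rewrite dvdzE /= dvdn_exp //.
  by move: i_ev i0; case: i => [|[]].
split; try exact: ndvd_pow; try exact: forced.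
rewrite -!rmorphXn -!PoszM -PoszD /P /Q -oxE -oyE.
by rewrite -/(radical_part p x) -/(radical_part q y) !odd_part_pow E -lE.
Qed.

Lemma class_base x y z : odd x = ox -> odd y = oy ->
  (0 < x)%N -> (0 < y)%N -> (0 < z)%N -> (p ^ x + q ^ y = c ^ z)%N ->
  (scale_l c)%:Z ^+ 2 < P%:Z * Q%:Z \/
    [/\ scale_l c = 1%N, P%:Z = 1, Q%:Z = 1 & (1 < e1)%N].
Proof.
move=> oxE oyE x0 y0 z0 E; rewrite -PoszM.
rewrite (_ : (scale_l c)%:Z ^+ 2 = (scale_l c ^ 2)%N%:Z) // ltz_nat /scale_l.
case: eqP => [c2|_]; last first.
  have [p1 q1] := (prime_gt1 p_pr, prime_gt1 q_pr).
  rewrite /P /Q /e1; case: (ox); case: (oy); rewrite ?expn1 ?expn0 ?muln1 ?mul1n.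
  - by left; move: p1 q1; clear; nia.
  - by left.
  - by left.
  - by right.
left; have z3 := exp2_ge8 c2 x0 y0 E.
have [p_odd p3] : odd p /\ (3 <= p)%N by apply: odd_prime_ge3; rewrite -?c2.
have [q_odd q3] : odd q /\ (3 <= q)%N by apply: odd_prime_ge3; rewrite -?c2.
have {}E : ((p ^ x + q ^ y) %% 8 = 0)%N.
  by rewrite E c2 -(subnKC z3) expnD modnMr.
have half i b : odd i = b -> i = (b + i./2.*2)%N by move=> <-; rewrite odd_double_half.
(* For [c = 2] the bound [4 < P * Q] can only fail at [P * Q = 3] or [P * Q = 1]; the sum would then
   be 4 or 2 modulo 8, although [z >= 3]. *)
have not3 r s i j : r = 3%N -> odd s -> odd i = true -> odd j = false ->
    ((r ^ i + s ^ j) %% 8 <> 0)%N.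
  move=> -> s_odd /half -> /half ->; rewrite add0n expnS -modnDm -modnMm.
  by rewrite !expn_even_mod8.
rewrite /P /Q; case Eo: (ox); case Eo': (oy); rewrite ?expn1 ?expn0 ?muln1 ?mul1n.
- by move: p3 q3; clear; nia.
- have : p <> 3%N by move=> p3'; apply: (not3 p q x y); rewrite ?oxE ?oyE.
  by case: (p) p3 p_odd => [|[|[|[|[]]]]].
- have : q <> 3%N by move=> q3'; apply: (not3 q p y x); rewrite ?oxE ?oyE // addnC.
  by case: (q) q3 q_odd => [|[|[|[|[]]]]].
- exfalso; move: E; rewrite (half _ _ oxE) (half _ _ oyE) Eo Eo' !add0n -modnDm.
  by rewrite !expn_even_mod8.
Qed.

Lemma forced_dvd (r : nat) (b : bool) (X : int) :
  ((if b then 1%N else r) %| X)%Z -> (r %| r ^ b * `|X| ^ 2)%N.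
Proof.
case: b => [_|rX]; first by rewrite expn1 dvdn_mulr.
by rewrite expn0 mul1n -mulnn dvdn_mulr.
Qed.

(** Each term is zero or a positive multiple of its own prime. Two positive terms exceed
    [scale_l c ^ 2], which is 1 or 4; a single one would make [p] or [q] divide it, hence equal to
    [c]. *)
Lemma class_end (X Y : int) : (e1 %| X)%Z -> (e2 %| Y)%Z ->
  P%:Z * X ^+ 2 + Q%:Z * Y ^+ 2 <> (scale_l c)%:Z ^+ 2.
Proof.
move=> /forced_dvd pX /forced_dvd qY; rewrite !sqr_absz -!PoszM -PoszD => -[E].
have [p1 q1] := (prime_gt1 p_pr, prime_gt1 q_pr).
have [X0|X0] := posnP (P * `|X| ^ 2).
  move: E qY; rewrite X0 add0n -/Q => ->; rewrite /scale_l; case: eqP => [c2|_].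
    by rewrite Euclid_dvdX // dvdn_prime2 // => /andP[/eqP q2]; case: qc; rewrite q2.
  by rewrite dvdn1 => /eqP q1'; rewrite q1' in q1.
have [Y0|Y0] := posnP (Q * `|Y| ^ 2).
  move: E pX; rewrite Y0 addn0 -/P => ->; rewrite /scale_l; case: eqP => [c2|_].
    by rewrite Euclid_dvdX // dvdn_prime2 // => /andP[/eqP p2]; case: pc; rewrite p2.
  by rewrite dvdn1 => /eqP p1'; rewrite p1' in p1.
have := dvdn_leq X0 pX; have := dvdn_leq Y0 qY.
move: E; rewrite /scale_l; case: eqP => [c2|_]; last by move: p1 q1; clear; lia.
have [_ p3] : odd p /\ (3 <= p)%N by apply: odd_prime_ge3; rewrite -?c2.
have [_ q3] : odd q /\ (3 <= q)%N by apply: odd_prime_ge3; rewrite -?c2.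
by move: p3 q3; clear; lia.
Qed.

Lemma prime_pow_factor (r n : nat) (a f : int) : prime r ->
  (r ^ n)%N%:Z = a * f ^+ 2 -> 0 <= a ->
  exists e i, a = (r ^ e)%N%:Z /\ `|f|%N = (r ^ i)%N.
Proof.
move=> r_pr E a0; have {}E : (r ^ n = `|a| * `|f| ^ 2)%N.
  by move/(congr1 absz): E; rewrite abszM abszX.
have /(dvdn_pfactor _ _ r_pr)[e _ eE] : (`|a| %| r ^ n)%N by rewrite E dvdn_mulr.
have /(dvdn_pfactor _ _ r_pr)[i _ iE] : (`|f| %| r ^ n)%N.
  by rewrite E -mulnn mulnA dvdn_mull.
by exists e, i; split=> //; rewrite -eE gez0_abs.
Qed.

Lemma pow_factor_dvd (r n : nat) (a f : int) : prime r ->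
  (r ^ n)%N%:Z = a * f ^+ 2 -> 0 <= a -> (r %| a)%Z ->
  exists e i, [/\ (0 < e)%N, a = (r ^ e)%N%:Z & `|f|%N = (r ^ i)%N].
Proof.
move=> r_pr E a0 ra; have [e [i [aE iE]]] := prime_pow_factor r_pr E a0.
exists e, i; split=> //; rewrite lt0n; apply/eqP => e0.
move: ra; rewrite aE e0 dvdzE /= dvdn1 => /eqP r1.
by move: r_pr; rewrite r1.
Qed.

(** The parts of the minimal norm divide the powers of [p] and [q] in the solution and contain these
    primes, so they are prime powers with positive exponents. Then [quo_prime_powers] gives [m = 0]:
    every solution of the class is the minimal element itself. *)
Lemma class_sol t (u0 v0 : int) x y z : (0 < t)%N -> rep t u0 v0 ->
  (forall n u v, (0 < n < t)%N -> ~ rep n u v) ->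
  odd x = ox -> odd y = oy ->
  (0 < x)%N -> (0 < y)%N -> (0 < z)%N -> (p ^ x + q ^ y = c ^ z)%N ->
  [/\ (p ^ x)%N%:Z = P%:Z * u0 ^+ 2, (q ^ y)%N%:Z = Q%:Z * v0 ^+ 2
     & shift_exp c z = t].
Proof.
move=> t0 rep0 minimal oxE oyE x0 y0 z0 E.
have [n0 lE] := shift_expE x0 y0 z0 E.
have scale := prime_scale_ok c_pr.
have cP : ~~ (c %| P%:Z)%Z by apply: ndvd_pow.
have cQ : ~~ (c %| Q%:Z)%Z by apply: ndvd_pow.
have P0 : 0 < P%:Z by rewrite ltz_nat expn_gt0 prime_gt0.
have Q0 : 0 < Q%:Z by rewrite ltz_nat expn_gt0 prime_gt0.
have co1 : coprime e1 (scale_l c * c) by apply: coprime_forced.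
have co2 : coprime e2 (scale_l c * c) by apply: coprime_forced.
have base := class_base oxE oyE x0 y0 z0 E.
have [m [d1 [d2 [d1E d2E nE uE vE]]]] :=
  descent c_pr scale cP cQ P0 Q0 co1 co2 base t0 rep0 minimal n0
    (sol_rep oxE oyE x0 y0 z0 E) (or_introl class_end).
set A := (scale_k c)%:Z * P%:Z * u0 ^+ 2 in uE vE; set N := c%:Z ^+ t in uE vE.
have sq_sign (d : int) : d = 1 \/ d = -1 -> d ^+ 2 = 1 by case=> ->.
have pxE : (p ^ x)%N%:Z = P%:Z * u0 ^+ 2 * vquo A N m ^+ 2.
  transitivity (P%:Z * (p ^ x./2)%N%:Z ^+ 2).
    by rewrite -(odd_part_pow p x) /radical_part oxE.
  rewrite uE.
  transitivity (d1 ^+ 2 * (P%:Z * u0 ^+ 2 * vquo A N m ^+ 2)); first by ring.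
  by rewrite sq_sign // mul1r.
have qyE : (q ^ y)%N%:Z = Q%:Z * v0 ^+ 2 * uquo A N m ^+ 2.
  transitivity (Q%:Z * (q ^ y./2)%N%:Z ^+ 2).
    by rewrite -(odd_part_pow q y) /radical_part oyE.
  rewrite vE.
  transitivity (d2 ^+ 2 * (Q%:Z * v0 ^+ 2 * uquo A N m ^+ 2)); first by ring.
  by rewrite sq_sign // mul1r.
have [uv0E _ _ eu0 ev0] := rep0.
have [||e [i [e0 aE iE]]] := pow_factor_dvd p_pr pxE.
- by rewrite mulr_ge0 // sqr_ge0.
- by rewrite sqr_absz -PoszM dvdzE /= forced_dvd.
have [||f [j [f0 bE jE]]] := pow_factor_dvd q_pr qyE.
- by rewrite mulr_ge0 // sqr_ge0.
- by rewrite sqr_absz -PoszM dvdzE /= forced_dvd.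
have AE : A = (scale_k c * p ^ e)%N%:Z by rewrite /A -mulrA aE PoszM.
have NE : N = (c ^ t)%N%:Z by rewrite /N -rmorphXn.
have sumE : (p ^ e + q ^ f = scale_l c ^ 2 * c ^ t)%N.
  move: uv0E; rewrite aE bE -/N NE sqr_absz -PoszM -PoszD /=.
  by case.
rewrite AE NE in iE jE.
have [m0|//] := quo_prime_powers p_pr q_pr c_pr pq pc qc scale e0 f0 t0 sumE iE jE.
move: pxE qyE nE; rewrite m0 vquo0 uquo0 expr1n !mulr1 mul1n.
by split.
Qed.

End OneClass.

Theorem parity_class_unique x y z x' y' z' :
  (0 < x)%N -> (0 < y)%N -> (0 < z)%N -> (p ^ x + q ^ y = c ^ z)%N ->
  (0 < x')%N -> (0 < y')%N -> (0 < z')%N -> (p ^ x' + q ^ y' = c ^ z')%N ->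
  odd x = odd x' -> odd y = odd y' -> [/\ x = x', y = y' & z = z'].
Proof.
move=> x0 y0 z0 E x0' y0' z0' E' oxE oyE.
have [t [[t0 [u0 [v0 rep0]]] tmin]] : exists t, ((0 < t)%N /\ exists u v,
     is_rep c (scale_l c) (if odd x then 1%N else p) (if odd y then 1%N else q)
       (p ^ odd x)%N%:Z (q ^ odd y)%N%:Z t u v) /\
   forall n, (n < t)%N -> ~ ((0 < n)%N /\ exists u v,
     is_rep c (scale_l c) (if odd x then 1%N else p) (if odd y then 1%N else q)
       (p ^ odd x)%N%:Z (q ^ odd y)%N%:Z n u v).
  apply: ex_minimal; exists (shift_exp c z); have [n0 _] := shift_expE x0 y0 z0 E.
  by split=> //; do 2!eexists; apply: sol_rep x0 y0 z0 E.
have minimal n u v : (0 < n < t)%N -> ~ is_rep c (scale_l c)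
    (if odd x then 1%N else p) (if odd y then 1%N else q)
       (p ^ odd x)%N%:Z (q ^ odd y)%N%:Z n u v.
  by case/andP=> n0 /tmin nrep rep; apply: nrep; split=> //; exists u, v.
have [px qy _] := class_sol t0 rep0 minimal erefl erefl x0 y0 z0 E.
have [px' qy' _] := class_sol t0 rep0 minimal (esym oxE) (esym oyE) x0' y0' z0' E'.
have xx : x = x'.
  by apply/eqP; rewrite -(eqn_exp2l _ _ (prime_gt1 p_pr)) -eqz_nat px px'.
have yy : y = y'.
  by apply/eqP; rewrite -(eqn_exp2l _ _ (prime_gt1 q_pr)) -eqz_nat qy qy'.
split=> //; apply/eqP; rewrite -(eqn_exp2l _ _ (prime_gt1 c_pr)).
by rewrite -E -E' xx yy.
Qed.

End ParityClass.

(** * Powers of two *)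

Lemma even_sum_pow (w : int) n : ~~ (2%N %| w)%Z ->
  (2%N %| \sum_(i < n) w ^+ i)%Z = ~~ odd n.
Proof.
move=> w_odd; elim: n => [|n IHn]; first by rewrite big_ord0 dvdz0.
have wn : ~~ (2%N %| w ^+ n)%Z by rewrite Euclid_dvdzX // negb_and w_odd.
rewrite big_ord_recr /= negbK.
move: IHn wn; set S := \sum_(_ < _) _; set W := w ^+ n.
by case: (odd n); lia.
Qed.

(** The cofactor of [w - 1] in [w ^+ n - 1] is a sum of an odd number of odd terms. *)
Lemma exp2_dvd_pow_sub1 (w : int) n s : ~~ (2%N %| w)%Z -> odd n ->
  (2%:Z ^+ s %| w ^+ n - 1)%Z -> (2%:Z ^+ s %| w - 1)%Z.
Proof.
move=> w_odd n_odd; rewrite subrX1 Gauss_dvdzl // coprimezE abszX.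
by rewrite coprimeXl // prime_coprime // -[2%N]/`|2%N%:Z|%N -dvdzE even_sum_pow // n_odd.
Qed.

Section PowerOfTwo.
Variables p q : nat.
Hypotheses (p_odd : odd p) (q_odd : odd q) (p_gt1 : (1 < p)%N) (q_gt1 : (1 < q)%N).

Lemma oddz n : odd n -> ~~ (2%N %| n%:Z)%Z.
Proof. by rewrite dvdzE /= dvdn2 negbK. Qed.

Lemma exp2_lt n m s : (0 < n)%N -> (n < 2 ^ m)%N -> (2%:Z ^+ s %| n%:Z)%Z -> (s < m)%N.
Proof.
move=> n0 nm; rewrite dvdzE abszX /= => /(dvdn_leq n0) /leq_ltn_trans /(_ nm).
by rewrite ltn_exp2l.
Qed.

Lemma odd_even_ascent x y z s : odd x -> ~~ odd y -> (0 < y)%N ->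
  (p ^ x + q ^ y = 2 ^ z)%N ->
  (2%:Z ^+ s %| q%:Z + 1)%Z \/ (2%:Z ^+ s %| q%:Z - 1)%Z ->
  (2%:Z ^+ s.+1 %| p%:Z + 1)%Z.
Proof.
move=> x_odd y_even y0 E q2.
have x0 : (0 < x)%N by case: (x) x_odd.
have qy : (q ^ 2 <= q ^ y)%N by rewrite leq_exp2l //; move: y_even y0; case: y {E} => [|[]].
have px : (p <= p ^ x)%N by rewrite -{1}(expn1 p) leq_exp2l.
have sz : (s < z)%N.
  case: q2 => q2.
    apply: (@exp2_lt (q + 1) z s); first by rewrite addn1.
      by rewrite -E; rewrite -mulnn in qy; move: qy px p_gt1 q_gt1; clear; nia.
    by rewrite PoszD.
  apply: (@exp2_lt (q - 1) z s); first by rewrite subn_gt0.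
    by rewrite -E; rewrite -mulnn in qy; move: qy px p_gt1 q_gt1; clear; nia.
  by rewrite -subzn // ltnW.
have q2' : (2%:Z ^+ s.+1 %| q%:Z ^+ 2 - 1)%Z.
  have -> : q%:Z ^+ 2 - 1 = (q%:Z - 1) * (q%:Z + 1) by ring.
  have q_pm : (2 %| q%:Z - 1)%Z /\ (2 %| q%:Z + 1)%Z.
    by rewrite !dvdzE; move: q_odd; clear; lia.
  rewrite exprS; case: q2 => q2; [|rewrite [2%:Z * _]mulrC].
    by rewrite dvdz_mul //; case: q_pm.
  by rewrite dvdz_mul //; case: q_pm.
have qy2 : (2%:Z ^+ s.+1 %| q%:Z ^+ y - 1)%Z.
  rewrite -(odd_double_half y) (negbTE y_even) add0n -mul2n exprM subrX1.
  by rewrite dvdz_mulr.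
have : (2%:Z ^+ s.+1 %| (- p%:Z) ^+ x - 1)%Z.
  have -> : (- p%:Z) ^+ x - 1 = (q%:Z ^+ y - 1) - 2%:Z ^+ z.
    rewrite exprNn -signr_odd x_odd expr1 mulN1r.
    have : p%:Z ^+ x + q%:Z ^+ y = 2%:Z ^+ z.
      by rewrite -!rmorphXn -PoszD; exact: (congr1 Posz E).
    by move=> <-; ring.
  by rewrite rpredB // dvdz_exp2l.
have mp_odd : ~~ (2%N %| - p%:Z)%Z by rewrite dvdzE abszN -dvdzE oddz.
move/(exp2_dvd_pow_sub1 mp_odd x_odd).
by rewrite -opprD !dvdzE abszN.
Qed.

Lemma odd_odd_transfer x y z s : odd x -> odd y ->
  (p ^ x + q ^ y = 2 ^ z)%N ->
  (2%:Z ^+ s %| p%:Z + 1)%Z -> (2%:Z ^+ s %| q%:Z - 1)%Z.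
Proof.
move=> x_odd y_odd E p2.
have x0 : (0 < x)%N by case: (x) x_odd.
have y0 : (0 < y)%N by case: (y) y_odd.
have qy : (q <= q ^ y)%N by rewrite -{1}(expn1 q) leq_exp2l.
have px : (p <= p ^ x)%N by rewrite -{1}(expn1 p) leq_exp2l.
have sz : (s < z)%N.
  apply: (@exp2_lt (p + 1) z s); first by rewrite addn1.
    by rewrite -E; move: qy px p_gt1 q_gt1; clear; lia.
  by rewrite PoszD.
apply: (@exp2_dvd_pow_sub1 _ y); rewrite ?oddz //.
have -> : q%:Z ^+ y - 1 = 2%:Z ^+ z + ((- p%:Z) ^+ x - 1).
  rewrite exprNn -signr_odd x_odd expr1 mulN1r.
  have : p%:Z ^+ x + q%:Z ^+ y = 2%:Z ^+ z.
    by rewrite -!rmorphXn -PoszD; exact: (congr1 Posz E).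
  by move=> <-; ring.
rewrite rpredD ?dvdz_exp2l 1?ltnW // subrX1 dvdz_mulr // -opprD.
by move: p2; rewrite !dvdzE abszN.
Qed.

Lemma unbounded_exp2 (w : int) : w != 0 ->
  ~ (forall s, (2%:Z ^+ s %| w)%Z).
Proof.
move=> w0 /(_ `|w|%N); rewrite dvdzE abszX /= => /dvdn_leq.
by rewrite absz_gt0 w0 => /(_ isT); rewrite leqNgt ltn_expl.
Qed.

End PowerOfTwo.

(* In both pairs of classes below, the two equations feed each other: every power
   of [2] dividing [q - 1] (resp. [q + 1]) can be doubled. *)
Lemma no_oe_oo p q x y z x' y' z' : odd p -> odd q -> (1 < p)%N -> (1 < q)%N ->
  odd x -> ~~ odd y -> (0 < y)%N -> (p ^ x + q ^ y = 2 ^ z)%N ->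
  odd x' -> odd y' -> (p ^ x' + q ^ y' = 2 ^ z')%N -> False.
Proof.
move=> p_odd q_odd p1 q1 ox oy y0 E ox' oy' E'.
apply: (@unbounded_exp2 (q%:Z - 1)); first by rewrite subr_eq0; move: q1; clear; lia.
elim=> [|s IHs]; first by rewrite dvd1z.
apply: (@odd_odd_transfer p q _ _ _ x' y' z') => //.
by apply: (@odd_even_ascent p q _ _ _ _ x y z) => //; right.
Qed.

Lemma no_oe_eo p q x y z x' y' z' : odd p -> odd q -> (1 < p)%N -> (1 < q)%N ->
  odd x -> ~~ odd y -> (0 < y)%N -> (p ^ x + q ^ y = 2 ^ z)%N ->
  ~~ odd x' -> odd y' -> (0 < x')%N -> (p ^ x' + q ^ y' = 2 ^ z')%N -> False.
Proof.
move=> p_odd q_odd p1 q1 ox oy y0 E ox' oy' x0' E'.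
have up s : (2%:Z ^+ s %| q%:Z + 1)%Z -> (2%:Z ^+ s.+1 %| q%:Z + 1)%Z.
  move=> q2; have p2 : (2%:Z ^+ s.+1 %| p%:Z + 1)%Z.
    by apply: (@odd_even_ascent p q _ _ _ _ x y z) => //; left.
  rewrite addnC in E'.
  have : (2%:Z ^+ s.+2 %| q%:Z + 1)%Z.
    by apply: (@odd_even_ascent q p _ _ _ _ y' x' z') => //; left.
  by apply: dvdz_trans; rewrite dvdz_exp2l.
apply: (@unbounded_exp2 (q%:Z + 1)); first by clear; lia.
by elim=> [|s IHs]; [rewrite dvd1z | apply: up].
Qed.

Theorem power_of_two_unique (p q x y z x' y' z' : nat) :
  prime p -> prime q -> p <> q -> p <> 2%N -> q <> 2%N ->
  ~ (p * q = 15 \/ p * q = 39)%N ->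
  (0 < x)%N -> (0 < y)%N -> (0 < z)%N -> (p ^ x + q ^ y = 2 ^ z)%N ->
  (0 < x')%N -> (0 < y')%N -> (0 < z')%N -> (p ^ x' + q ^ y' = 2 ^ z')%N ->
  [/\ x = x', y = y' & z = z'].
Proof.
move=> p_pr q_pr pq p2 q2 reg x0 y0 z0 E x0' y0' z0' E'.
have [p_odd _] := odd_prime_ge3 p_pr p2; have [q_odd _] := odd_prime_ge3 q_pr q2.
have [p1 q1] := (prime_gt1 p_pr, prime_gt1 q_pr).
(* Two odd squares add up to 2 modulo 8, while [d >= 3]. *)
have not_ee a b d : (0 < a)%N -> (0 < b)%N -> (0 < d)%N ->
    (p ^ a + q ^ b = 2 ^ d)%N -> odd a || odd b.
  move=> a0 b0 d0 Eabd; rewrite -[_ || _]negbK negb_or; apply/negP => /andP[a_ev b_ev].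
  have d3 := @exp2_ge8 p q 2 p_pr q_pr p2 q2 a b d erefl a0 b0 Eabd.
  have : ((p ^ a + q ^ b) %% 8 = 0)%N by rewrite Eabd -(subnKC d3) expnD modnMr.
  rewrite -(odd_double_half a) -(odd_double_half b) (negbTE a_ev) (negbTE b_ev).
  by rewrite !add0n -modnDm !expn_even_mod8.
have reg' : ~ (2 = 2 /\ (p * q = 15 \/ p * q = 39))%N by case.
have uniq := @parity_class_unique p q 2 p_pr q_pr isT pq p2 q2 reg'
  x y z x' y' z' x0 y0 z0 E x0' y0' z0' E'.
have := not_ee _ _ _ x0 y0 z0 E; have := not_ee _ _ _ x0' y0' z0' E'.
have sE : (q ^ y + p ^ x = 2 ^ z)%N by rewrite addnC.
have sE' : (q ^ y' + p ^ x' = 2 ^ z')%N by rewrite addnC.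
case ox: (odd x); case oy: (odd y); case ox': (odd x'); case oy': (odd y') => // _ _;
  try (by apply: uniq; rewrite ?ox ?oy ?ox' ?oy'); exfalso.
- by apply: (@no_oe_oo p q x' y' z' x y z); rewrite ?ox ?oy ?ox' ?oy'.
- by apply: (@no_oe_oo q p y' x' z' y x z); rewrite ?ox ?oy ?ox' ?oy'.
- by apply: (@no_oe_oo p q x y z x' y' z'); rewrite ?ox ?oy ?ox' ?oy'.
- by apply: (@no_oe_eo p q x y z x' y' z'); rewrite ?ox ?oy ?ox' ?oy'.
- by apply: (@no_oe_oo q p y x z y' x' z'); rewrite ?ox ?oy ?ox' ?oy'.
- by apply: (@no_oe_eo p q x' y' z' x y z); rewrite ?ox ?oy ?ox' ?oy'.
Qed.

(** * A 2-adic argument *)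

(* The pair [(x, y)] stands for [x + y sqrt d]. *)
Definition qmul (d : int) (a b : int * int) : int * int :=
  (a.1 * b.1 + d * a.2 * b.2, a.1 * b.2 + a.2 * b.1).

Fixpoint qpow (d : int) (a : int * int) n :=
  if n is n'.+1 then qmul d a (qpow d a n') else (1, 0).

Lemma qpowD d a m n : qpow d a (m + n) = qmul d (qpow d a m) (qpow d a n).
Proof.
elim: m => [|m IHm].
  by rewrite /qmul /=; case: (qpow d a n) => x y /=; congr pair; ring.
by rewrite addSn /= IHm /qmul /=; congr pair; ring.
Qed.

(* Squaring only replaces [X] by [2 * X], so a positive power [(x, y)] of an element
   near [1] in this sense never has [x + w * y] equal to [1] or [-1], [w] odd. *)
Definition near_one (X : int) (a : int * int) :=
  exists al be : int, a = (1 + 8 * X * al, 4 * X + 8 * X * be).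

Lemma near_one_sq d X a : (2 %| d)%Z -> near_one X a ->
  near_one (2 * X) (qmul d a a).
Proof.
case/dvdzP => d' -> [al [be ->]].
exists (al + 4 * X * al ^+ 2 + 2 * d' * X * (1 + 2 * be) ^+ 2),
  (be + 4 * X * al * (1 + 2 * be)).
by rewrite /qmul /=; congr pair; ring.
Qed.

Lemma near_one_mul d Y a b : near_one (2 * Y) a -> near_one 1 b ->
  near_one 1 (qmul d b a).
Proof.
case=> al [be ->] [al' [be' ->]].
exists (al' + 2 * Y * al * (1 + 8 * al') + 4 * d * Y * (1 + 2 * be) * (1 + 2 * be')),
  (be' + 2 * Y * al * (4 + 8 * be') + Y * (1 + 2 * be) * (1 + 8 * al')).
by rewrite /qmul /=; congr pair; ring.
Qed.

(** The induction halves [n]: a square doubles the parameter, whence [2 * Y] for even [n], and the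
    extra factor of an odd power resets it to 1. *)
Lemma qpow_near_one d a n : (2 %| d)%Z -> near_one 1 a -> (0 < n)%N ->
  exists Y : int, Y != 0 /\
    near_one (if odd n then 1 else 2 * Y) (qpow d a n).
Proof.
move=> d2 a1; elim/ltn_ind: n => n IHn n0.
have even_case m : (0 < m)%N -> (m < n)%N ->
    exists Y : int, Y != 0 /\ near_one (2 * Y) (qpow d a m.*2).
  move=> m0 mn; have [Y [Y0 nearY]] := IHn m mn m0.
  rewrite -addnn qpowD; exists (if odd m then 1 else 2 * Y); split.
    by case: ifP => // _; rewrite mulf_neq0.
  exact: near_one_sq.
have [nE|nE] : n = n./2.*2 \/ n = n./2.*2.+1.
- by rewrite -{1 3}(odd_double_half n); case: (odd n); [right|left].
- have [||Y [Y0 nearY]] := even_case n./2; try by move: nE n0; clear; lia.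
  by exists Y; split=> //; rewrite nE odd_double.
- have [h0|h0] := posnP n./2.
    exists 1; split=> //; rewrite nE h0 /=.
    by case: a1 => al [be ->]; exists al, be; rewrite /qmul /=; congr pair; ring.
  have [||Y [Y0 nearY]] := even_case n./2 => //; first by move: nE; clear; lia.
  by exists 1; split=> //; rewrite nE /= odd_double /=; apply: near_one_mul nearY a1.
Qed.

Lemma qpow_not_unit d a n (w : int) : (2 %| d)%Z -> near_one 1 a -> (0 < n)%N ->
  ~~ (2 %| w)%Z -> `|((qpow d a n).1 + w * (qpow d a n).2)%R|%N <> 1%N.
Proof.
move=> d2 a1 n0 w_odd; have [Y [Y0]] := qpow_near_one d2 a1 n0.
set X := (if _ then _ else _) => -[al [be ->]] /=.
have X0 : X != 0 by rewrite /X; case: ifP => // _; rewrite mulf_neq0.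
(* The factor multiplying [X] is odd because [w] is, hence nonzero, so the value differs from 1 by a
   nonzero multiple of 4. *)
have -> : 1 + 8 * X * al + w * (4 * X + 8 * X * be) =
  1 + 4 * (X * (2 * (al + w * be) + w)) by ring.
have : X * (2 * (al + w * be) + w) != 0.
  rewrite mulf_neq0 //; apply: contraNneq w_odd => E.
  by rewrite dvdzE; move: E; move: (al + w * be); clear; lia.
by move: (X * _); clear; lia.
Qed.

(** Here [g = sqrt a + sqrt (-1)], and [b] is [g ^ 4], written in terms of [sqrt (- a)]. The two
    formulas are the coefficients of [sqrt a] in [g * g ^ (4 n)] and [g ^ 3 * g ^ (4 n)]. *)
Lemma vquo_qpow (a : int) n :
  let b := (a ^+ 2 - 6 * a + 1, 4 * (a - 1)) in
  vquo (4 * a) (a + 1) n.*2 = (qpow (- a) b n).1 + (-1) * (qpow (- a) b n).2 /\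
  vquo (4 * a) (a + 1) n.*2.+1 =
    (a - 3) * (qpow (- a) b n).1 - (3 * a - 1) * (qpow (- a) b n).2.
Proof.
move=> b; elim: n => [|n [IH0 IH1]]; first by rewrite vquo0 vquo1 /=; split; ring.
rewrite doubleS; have E2 : vquo (4 * a) (a + 1) n.*2.+2 =
    (qpow (- a) b n.+1).1 + (-1) * (qpow (- a) b n.+1).2.
  by rewrite vquoSS IH0 IH1 /= /qmul /=; ring.
by split=> //; rewrite vquoSS E2 IH1 /= /qmul /=; ring.
Qed.

Lemma near_one_gen (a : int) : (2 %| a)%Z ->
  near_one 1 (a ^+ 2 - 6 * a + 1, 4 * (a - 1)).
Proof.
case/dvdzP => h ->; have [al alE] : exists al, h * (h - 3) = 2 * al.
  have [j [->|->]] : exists j, h = 2 * j \/ h = 2 * j + 1.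
  - by exists (h %/ 2)%Z; clear; lia.
  - by exists (j * (2 * j - 3)); ring.
  - by exists ((2 * j + 1) * (j - 1)); ring.
exists al, (h - 1); congr pair; last by ring.
transitivity (1 + 4 * (h * (h - 3))); first by ring.
by rewrite alE; ring.
Qed.

Lemma vquo_unit_even (a : int) n : (2 %| a)%Z ->
  `|vquo (4 * a) (a + 1) n.*2|%N = 1%N -> n = 0%N.
Proof.
move=> a2; case: (posnP n) => // n0; rewrite (vquo_qpow a n).1 => E.
have d2 : (2 %| - a)%Z by rewrite dvdzE abszN -dvdzE.
by case: (qpow_not_unit d2 (near_one_gen a2) n0 (_ : ~~ (2 %| -1)%Z) E).
Qed.

(** Among even [a], only 2 and 4 make [a - 3] equal to [-1] or [1], as [qpow_not_unit] needs. *)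
Lemma vquo_unit_odd (a : int) n : a = 2 \/ a = 4 ->
  `|vquo (4 * a) (a + 1) n.*2.+1|%N = 1%N -> n = 0%N.
Proof.
move=> a24; case: (posnP n) => // n0; rewrite (vquo_qpow a n).2 => E.
have a2 : (2 %| a)%Z by case: a24 => ->.
have d2 : (2 %| - a)%Z by rewrite dvdzE abszN -dvdzE.
exfalso; move: E; set x := qpow _ _ _; case: a24 => aE.
- have -> : (a - 3) * x.1 - (3 * a - 1) * x.2 = - (x.1 + 5 * x.2) by rewrite aE; ring.
  by rewrite abszN; apply: qpow_not_unit => //; apply: near_one_gen.
- have -> : (a - 3) * x.1 - (3 * a - 1) * x.2 = x.1 + (-11) * x.2 by rewrite aE; ring.
  by apply: qpow_not_unit => //; apply: near_one_gen.
Qed.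

(** * Thue's lemma *)

Lemma prime_between_squares c : prime c -> exists k, (k ^ 2 < c < k.+1 ^ 2)%N.
Proof.
move=> c_pr; have exk : exists k, (k ^ 2 <= c)%N by exists 0%N.
have bound k : (k ^ 2 <= c)%N -> (k <= c)%N.
  by move=> kc; apply: leq_trans kc; case: k => // k; rewrite -mulnn leq_pmulr.
case: (ex_maxnP exk bound) => k kc kmax; exists k; apply/andP; split.
  rewrite ltn_neqAle kc andbT; apply: contraTneq c_pr => <-.
  apply/negP => /primeP[k1 /(_ k)]; rewrite dvdn_exp // => /(_ isT).
  by rewrite -!mulnn in k1 *; move: k1; clear; nia.
by rewrite ltnNge; apply/negP => /kmax; rewrite ltnn.
Qed.

(** Pigeonhole: there are [k.+1 ^ 2 > c] pairs [(i, j)], so two of them give the same residue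
    [s * i - r * j]. Their difference satisfies [s * x = r * y] modulo [c]. *)
Lemma thue (c : nat) (r s D : int) : prime c ->
  (c %| r ^+ 2 + D * s ^+ 2)%Z -> ~~ (c %| s)%Z ->
  exists x y : int, [/\ (x, y) != (0, 0), x ^+ 2 < c%:Z, y ^+ 2 < c%:Z &
    (c %| x ^+ 2 + D * y ^+ 2)%Z].
Proof.
move=> c_pr crs cs; have [k /andP[k_lt k_gt]] := prime_between_squares c_pr.
pose f (ij : 'I_k.+1 * 'I_k.+1) : 'F_c :=
  (s * (ij.1 : nat)%:Z - r * (ij.2 : nat)%:Z)%:~R.
have : ~~ injectiveb f.
  apply/injectiveP => /leq_card; rewrite card_prod card_ord card_Fp //.
  by rewrite leqNgt mulnn k_gt.
case/injectivePn => -[i j] [[i' j'] ij_neq /eqP fE].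
pose x := (i : nat)%:Z - (i' : nat)%:Z; pose y := (j : nat)%:Z - (j' : nat)%:Z.
have csr : (c %| s * x - r * y)%Z.
  rewrite (dvdz_pcharf (pchar_Fp c_pr)).
  have -> : s * x - r * y =
    (s * (i : nat)%:Z - r * (j : nat)%:Z) - (s * (i' : nat)%:Z - r * (j' : nat)%:Z).
    by rewrite /x /y; ring.
  by rewrite rmorphB /= subr_eq0.
have small (a b : 'I_k.+1) : ((a : nat)%:Z - (b : nat)%:Z) ^+ 2 < c%:Z.
  apply: le_lt_trans (_ : (k ^ 2)%N%:Z < _) => //.
  rewrite sqr_absz lez_nat leq_exp2r //.
  by move: (ltn_ord a) (ltn_ord b); clear; lia.
exists x, y; split; try exact: small.
- apply: contra ij_neq => /eqP[/eqP x0 /eqP y0]; rewrite !subr_eq0 !eqz_nat in x0 y0.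
  by rewrite xpair_eqE -!val_eqE /= x0 y0.
- have : (c %| s ^+ 2 * (x ^+ 2 + D * y ^+ 2))%Z.
    have -> : s ^+ 2 * (x ^+ 2 + D * y ^+ 2) =
      (s * x - r * y) * (s * x + r * y) + (r ^+ 2 + D * s ^+ 2) * y ^+ 2 by ring.
    by rewrite rpredD // dvdz_mulr.
  by rewrite Euclid_dvdzM // Euclid_dvdzX // (negbTE cs).
Qed.

Lemma thue_mult (c D : nat) (r s : int) : prime c -> (0 < D)%N ->
  (c %| r ^+ 2 + D%:Z * s ^+ 2)%Z -> ~~ (c %| s)%Z ->
  exists (x y : int) (m : nat), (0 < m <= D)%N /\
    x ^+ 2 + D%:Z * y ^+ 2 = m%:Z * c%:Z.
Proof.
move=> c_pr D0 crs cs; have [x [y [xy0 xc yc cxy]]] := thue c_pr crs cs.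
case/dvdzP: cxy => m mE; have c0 : 0 < c%:Z by rewrite ltz_nat prime_gt0.
have x2 := sqr_ge0 x; have y2 := sqr_ge0 y.
have Dy2 : 0 <= D%:Z * y ^+ 2 by apply: mulr_ge0.
have pos : 0 < x ^+ 2 + D%:Z * y ^+ 2.
  rewrite lt0r; apply/andP; split; last exact: addr_ge0.
  apply: contra xy0.
  have DZ0 : D%:Z == 0 = false by move: D0; clear; lia.
  rewrite (paddr_eq0 x2 Dy2) sqrf_eq0 (mulf_eq0 D%:Z) DZ0 sqrf_eq0 /=.
  by case/andP => /eqP -> /eqP ->.
have m0 : 0 < m by move: pos; rewrite mE pmulr_lgt0.
have mD : m < D%:Z + 1.
  rewrite -(ltr_pM2r c0) -mE mulrDl mul1r addrC.
  by apply: ler_ltD => //; rewrite ler_pM2l ?ltz_nat // ltW.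
exists x, y, `|m|%N; rewrite gez0_abs ?ltW //; split=> //.
by move: m0 mD; clear; lia.
Qed.

Lemma thue1 (c : nat) (r s : int) : prime c ->
  (c %| r ^+ 2 + s ^+ 2)%Z -> ~~ (c %| s)%Z ->
  exists x y : int, c%:Z = x ^+ 2 + y ^+ 2.
Proof.
move=> c_pr crs cs; have [|||x [y [m [m1 E]]]] := @thue_mult c 1 r s c_pr => //.
  by rewrite mul1r.
exists x, y; move: E; rewrite mul1r => ->.
by rewrite (_ : m = 1%N) ?mul1r //; move: m1; clear; lia.
Qed.

Lemma thue2 (c : nat) (r s : int) : prime c ->
  (c %| r ^+ 2 + 2 * s ^+ 2)%Z -> ~~ (c %| s)%Z ->
  exists x y : int, c%:Z = 2 * x ^+ 2 + y ^+ 2.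
Proof.
move=> c_pr crs cs; have [|||x [y [m [m1 E]]]] := @thue_mult c 2 r s c_pr => //.
have [mE|mE] : m = 1%N \/ m = 2%N by move: m1; clear; lia.
  by exists y, x; move: E; rewrite mE mul1r => <-; rewrite addrC.
rewrite {}mE in E; have /dvdzP[h hE] : (2%N %| x)%Z.
  rewrite -[X in is_true X]andbT -(Euclid_dvdzX 2 x (isT : prime 2)).
  have -> : x ^+ 2 = 2%N%:Z * (c%:Z - y ^+ 2) by rewrite mulrBr -E; ring.
  by rewrite dvdz_mulr.
exists h, y; apply: (@mulfI _ (2 : int)) => //.
by move: E; rewrite hE => <-; ring.
Qed.

(** The forms of discriminant -24 are [x ^ 2 + 6 * y ^ 2] and [2 * x ^ 2 + 3 * y ^ 2], and modulo 3
    the first cannot represent [c]. The multipliers 1, 4, 6 lead to the first form, and 2, 3, 5 to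
    the second. *)
Lemma thue6 (c : nat) (r s : int) : prime c -> (c %% 24 = 11)%N ->
  (c %| r ^+ 2 + 6 * s ^+ 2)%Z -> ~~ (c %| s)%Z ->
  exists x y : int, c%:Z = 2 * x ^+ 2 + 3 * y ^+ 2.
Proof.
move=> c_pr c24 crs cs; have [|||x [y [m [m1 E]]]] := @thue_mult c 6 r s c_pr => //.
have dvd_sq d (w : int) : prime d -> (d %| w ^+ 2)%Z -> exists h, w = d%:Z * h.
  move=> d_pr; rewrite Euclid_dvdzX // andbT => /dvdzP[h ->].
  by exists h; rewrite mulrC.
have sq_mod3 (w : int) : exists h, w ^+ 2 = 3 * h \/ w ^+ 2 = 3 * h + 1.
  have [j [->|[->|->]]] : exists j, w = 3 * j \/ w = 3 * j + 1 \/ w = 3 * j + 2.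
  - by exists (w %/ 3)%Z; clear; lia.
  - by exists (3 * j ^+ 2); left; ring.
  - by exists (3 * j ^+ 2 + 2 * j); right; ring.
  - by exists (3 * j ^+ 2 + 4 * j + 1); right; ring.
have not1 (v w : int) : v ^+ 2 + 6 * w ^+ 2 <> c%:Z.
  have [h hE] := sq_mod3 v; move: c24 hE; move: (v ^+ 2) (w ^+ 2); clear; lia.
have [mE|[mE|[mE|[mE|[mE|mE]]]]] :
  m = 1%N \/ m = 2%N \/ m = 3%N \/ m = 4%N \/ m = 5%N \/ m = 6%N.
- by move: m1; clear; lia.
- by case: (not1 x y); rewrite E mE mul1r.
- rewrite {}mE in E; have [|h xE] := dvd_sq 2%N x isT.
    have -> : x ^+ 2 = 2%N%:Z * (c%:Z - 3 * y ^+ 2) by rewrite mulrBr -E; ring.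
    by rewrite dvdz_mulr.
  exists h, y; apply: (@mulfI _ (2 : int)) => //.
  by move: E; rewrite xE => <-; ring.
- rewrite {}mE in E; have [|h xE] := dvd_sq 3%N x isT.
    have -> : x ^+ 2 = 3%N%:Z * (c%:Z - 2 * y ^+ 2) by rewrite mulrBr -E; ring.
    by rewrite dvdz_mulr.
  exists y, h; apply: (@mulfI _ (3 : int)) => //.
  by move: E; rewrite xE => <-; ring.
- rewrite {}mE in E; have [|h xE] := dvd_sq 2%N x isT.
    have -> : x ^+ 2 = 2%N%:Z * (2 * c%:Z - 3 * y ^+ 2).
      transitivity (4%N%:Z * c%:Z - 6 * y ^+ 2); last by ring.
      by rewrite -E; ring.
    by rewrite dvdz_mulr.
  have E' : 2 * h ^+ 2 + 3 * y ^+ 2 = 2 * c%:Z.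
    apply: (@mulfI _ (2 : int)) => //.
    transitivity (4%N%:Z * c%:Z); last by ring.
    by rewrite -E xE; ring.
  have [|j yE] := dvd_sq 2%N y isT.
    have -> : y ^+ 2 = 2%N%:Z * (c%:Z - h ^+ 2 - y ^+ 2).
      by rewrite !mulrBr -E'; ring.
    by rewrite dvdz_mulr.
  case: (not1 h j); apply: (@mulfI _ (2 : int)) => //.
  by rewrite -E' yE; ring.
- have {}E : x ^+ 2 + 6 * y ^+ 2 = 5 * c%:Z by rewrite E mE.
  (* Since [6 = -4 + 10], [x ^ 2 = 4 * y ^ 2] modulo 5; each sign allows a division by
     [5 = 2 + 3]. *)
  have /orP[] : (5%N %| x - 2 * y)%Z || (5%N %| x + 2 * y)%Z.
  + rewrite -Euclid_dvdzM //.
    have -> : (x - 2 * y) * (x + 2 * y) = 5%N%:Z * (c%:Z - 2 * y ^+ 2).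
      by rewrite mulrBr -E; ring.
    by rewrite dvdz_mulr.
  + case/dvdzP => h xE; have {}xE : x = 5 * h + 2 * y by rewrite -[x](subrK (2 * y)) xE; ring.
    exists (h + y), h; apply: (@mulfI _ (5 : int)) => //; rewrite -E xE; ring.
  + case/dvdzP => h xE; have {}xE : x = 5 * h - 2 * y by rewrite -[x](addrK (2 * y)) xE; ring.
    exists (h - y), h; apply: (@mulfI _ (5 : int)) => //; rewrite -E xE; ring.
- have {}E : x ^+ 2 + 6 * y ^+ 2 = 6 * c%:Z by rewrite E mE.
  have [|h xE] := dvd_sq 2%N x isT.
    have -> : x ^+ 2 = 2%N%:Z * (3 * c%:Z - 3 * y ^+ 2).
      transitivity (6 * c%:Z - 6 * y ^+ 2); last by ring.
      by rewrite -E; ring.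
    by rewrite dvdz_mulr.
  have [|j hE] := dvd_sq 3%N h isT.
    have -> : h ^+ 2 = 3%N%:Z * (2 * c%:Z - 2 * y ^+ 2 - h ^+ 2).
      transitivity (6 * c%:Z - 6 * y ^+ 2 - 3 * h ^+ 2); last by ring.
      by rewrite -E xE; ring.
    by rewrite dvdz_mulr.
  case: (not1 y j); apply: (@mulfI _ (6 : int)) => //.
  by rewrite -E xE hE; ring.
Qed.

(** As [c] itself is represented, [t = 1] and minimality is vacuous. With [z] and [t] both odd the
    descent never meets norm 1, so no divisor of [v] has to be prescribed. *)
Lemma prime_rep_pow (c e1 z : nat) (P Q u0 v0 U V : int) :
  prime c -> odd c -> ~~ (c %| P)%Z -> ~~ (c %| Q)%Z -> 0 < P -> 0 < Q ->
  coprime e1 c -> 1 < P * Q \/ [/\ P = 1, Q = 1 & (1 < e1)%N] ->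
  c%:Z = P * u0 ^+ 2 + Q * v0 ^+ 2 -> (e1 %| u0)%Z ->
  odd z -> P * U ^+ 2 + Q * V ^+ 2 = c%:Z ^+ z ->
  ~~ (c %| U)%Z -> ~~ (c %| V)%Z -> (e1 %| U)%Z ->
  exists m, [/\ z = m.*2.+1, U ^+ 2 = u0 ^+ 2 * vquo (4 * P * u0 ^+ 2) c%:Z m ^+ 2 &
    V ^+ 2 = v0 ^+ 2 * uquo (4 * P * u0 ^+ 2) c%:Z m ^+ 2].
Proof.
move=> c_pr c_odd cP cQ P0 Q0 co base cE eu z_odd E cU cV eU.
have scale : scale_ok 4 1 c by left.
have co1 : coprime e1 (1 * c) by rewrite mul1n.
have co2 : coprime 1 (1 * c) by rewrite coprime1n.
have base' : 1%N%:Z ^+ 2 < P * Q \/ [/\ 1%N = 1%N, P = 1, Q = 1 & (1 < e1)%N].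
  by case: base => [|[? ? ?]]; [left | right].
have not_both : ~~ ((c %| u0)%Z && (c %| v0)%Z).
  apply/negP => /andP[/dvdzP[a aE] /dvdzP[b bE]].
  have : (c%:Z ^+ 2 %| P * u0 ^+ 2 + Q * v0 ^+ 2)%Z.
    by rewrite aE bE !exprMn rpredD // dvdz_mull // dvdz_mull.
  rewrite -cE dvdzE abszX /= => /(dvdn_leq (prime_gt0 c_pr)).
  by rewrite leqNgt -{1}(expn1 c) ltn_exp2l // prime_gt1.
have cu0 : ~~ (c %| u0)%Z.
  apply: contra not_both => cu; rewrite cu /=.
  have : (c %| Q * v0 ^+ 2)%Z.
    have -> : Q * v0 ^+ 2 = c%:Z - P * u0 ^+ 2 by rewrite cE; ring.
    by rewrite rpredB // dvdz_mull // Euclid_dvdzX // cu.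
  by rewrite Euclid_dvdzM // Euclid_dvdzX // (negbTE cQ) andbT.
have cv0 : ~~ (c %| v0)%Z.
  apply: contra not_both => cv; rewrite cv andbT.
  have : (c %| P * u0 ^+ 2)%Z.
    have -> : P * u0 ^+ 2 = c%:Z - Q * v0 ^+ 2 by rewrite cE; ring.
    by rewrite rpredB // dvdz_mull // Euclid_dvdzX // cv.
  by rewrite Euclid_dvdzM // Euclid_dvdzX // (negbTE cP) andbT.
have rep0 : is_rep c 1 e1 1 P Q 1 u0 v0.
  by split=> //; rewrite -?cE ?expr1n ?mul1r ?expr1 // dvd1z.
have rep : is_rep c 1 e1 1 P Q z U V.
  by split=> //; rewrite ?E ?expr1n ?mul1r // dvd1z.
have minimal n u v : (0 < n < 1)%N -> ~ is_rep c 1 e1 1 P Q n u v by case: n.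
have z0 : (0 < z)%N by case: (z) z_odd.
have [m [d1 [d2 [d1E d2E zE UE VE]]]] :=
  descent c_pr scale cP cQ P0 Q0 co1 co2 base' (isT : (0 < 1)%N) rep0 minimal z0
    rep (or_intror (conj z_odd isT)).
rewrite expr1 in UE VE; exists m; split; first by rewrite zE muln1.
- by rewrite UE; case: d1E => ->; ring.
- by rewrite VE; case: d2E => ->; ring.
Qed.

(** * Exponent one *)

Lemma Posz_exp (a n : nat) : (a ^ n)%N%:Z = a%:Z ^+ n.
Proof. by rewrite -rmorphXn. Qed.

Lemma dvd_pow_sum (c z : nat) (s : int) : (0 < z)%N ->
  s = c%:Z ^+ z -> (c %| s)%Z.
Proof. by move=> z0 ->; rewrite -(prednK z0) exprS dvdz_mulr. Qed.

(* When the prime [c] is itself represented by the form, an exponent above [1]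
   contradicts [quo_prime_powers], unless the [q]-part of that representation
   is trivial. *)
Lemma rep_exponent_one (c q z x y : nat) (P Q u0 v0 : int) (e1 : nat) (U V : int) :
  prime c -> odd c -> prime q -> q <> 2%N -> q <> c ->
  ~~ (c %| P)%Z -> ~~ (c %| Q)%Z -> 0 < P -> 0 < Q ->
  coprime e1 c -> 1 < P * Q \/ [/\ P = 1, Q = 1 & (1 < e1)%N] ->
  c%:Z = P * u0 ^+ 2 + Q * v0 ^+ 2 -> (e1 %| u0)%Z -> (2 %| P * u0 ^+ 2)%Z ->
  odd z -> P * U ^+ 2 = (2 ^ x)%N%:Z -> Q * V ^+ 2 = (q ^ y)%N%:Z ->
  (2 ^ x + q ^ y = c ^ z)%N -> (e1 %| U)%Z ->
  z = 1%N \/ exists m, [/\ z = m.*2.+1, Q * v0 ^+ 2 = 1, P * u0 ^+ 2 = (2 ^ x)%N%:Z &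
     `|vquo (4 * (2 ^ x)%N%:Z) c%:Z m|%N = 1%N].
Proof.
move=> c_pr c_odd q_pr q2 qc cP cQ P0 Q0 co base cE eu u_even z_odd UE VE E eU.
have c2 : 2%N <> c by move=> c2; rewrite -c2 in c_odd.
have z0 : (0 < z)%N by case: (z) z_odd.
have cU : ~~ (c %| U)%Z.
  apply/negP => cU; have : (c %| (2 ^ x)%N%:Z)%Z.
    by rewrite -UE dvdz_mull // Euclid_dvdzX // cU.
  rewrite dvdzE /= Euclid_dvdX // dvdn_prime2 // => /andP[/eqP cE' _].
  exact: c2.
have cV : ~~ (c %| V)%Z.
  apply/negP => cV; have : (c %| (q ^ y)%N%:Z)%Z.
    by rewrite -VE dvdz_mull // Euclid_dvdzX // cV.
  rewrite dvdzE /= Euclid_dvdX // dvdn_prime2 // => /andP[/eqP cE' _].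
  exact: qc.
have normE : P * U ^+ 2 + Q * V ^+ 2 = c%:Z ^+ z.
  by rewrite UE VE -PoszD E Posz_exp.
have [m [zE U2 V2]] :=
  prime_rep_pow c_pr c_odd cP cQ P0 Q0 co base cE eu z_odd normE cU cV eU.
have AE : 4 * P * u0 ^+ 2 = 4 * (P * u0 ^+ 2) by rewrite mulrA.
rewrite AE in U2 V2.
set a := P * u0 ^+ 2 in cE u_even AE U2 V2 *.
have xE : (2 ^ x)%N%:Z = a * vquo (4 * a) c%:Z m ^+ 2 by rewrite -UE U2 mulrA.
have yE : (q ^ y)%N%:Z = Q * v0 ^+ 2 * uquo (4 * a) c%:Z m ^+ 2.
  by rewrite -VE V2 mulrA.
have a0 : 0 <= a by rewrite mulr_ge0 ?sqr_ge0 // ltW.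
have b0 : 0 <= Q * v0 ^+ 2 by rewrite mulr_ge0 ?sqr_ge0 // ltW.
have [e [i [aE iE]]] := prime_pow_factor (isT : prime 2) xE a0.
have [f [j [bE jE]]] := prime_pow_factor q_pr yE b0.
have e0 : (0 < e)%N.
  rewrite lt0n; apply/eqP => e0; move: u_even; rewrite aE e0.
  by [].
have sumE : (2 ^ e + q ^ f = 1 ^ 2 * c ^ 1)%N.
  by move: cE; rewrite aE bE -PoszD mul1n expn1 => -[].
have AE' : 4 * a = (4 * 2 ^ e)%N%:Z by rewrite aE PoszM.
have NE' : c%:Z = (c ^ 1)%N%:Z by rewrite expn1.
have [f0|f0] := posnP f; last first.
  left; rewrite AE' NE' in iE jE.
  have scale : scale_ok 4 1 c by left.
  have [m0|[c2' _]] := quo_prime_powers (isT : prime 2) q_pr c_pr (nesym q2) c2 qc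
    scale e0 f0 (isT : (0 < 1)%N) sumE iE jE; first by rewrite zE m0.
  by case: c2; rewrite c2'.
right; exists m; rewrite bE f0 expn0.
have v_odd : `|vquo (4 * a) c%:Z m|%N = 1%N.
  case: i iE => [|i] iE; first by rewrite iE.
  have : (2%N %| vquo (4 * a) c%:Z m)%Z by rewrite dvdzE iE /= dvdn_exp.
  rewrite prime_dvd_vquo //; first by rewrite dvdn2 /= odd_double.
    by rewrite dvdz_mulr.
  by rewrite dvdzE /= dvdn2 c_odd.
have axE : a = (2 ^ x)%N%:Z by rewrite xE sqr_absz v_odd mulr1.
by split=> //; rewrite -axE.
Qed.

(** [c] is a sum of two squares by [thue1]; the even one is put first, and the divisor 2 of that
    coordinate rules out the Gaussian units. The exceptional branch is [c = 4 ^ i + 1]. *)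
Lemma ee_exponent_one (b c i j z : nat) :
  prime b -> prime c -> odd c -> b <> 2%N -> b <> c -> (0 < i)%N -> (0 < j)%N -> odd z ->
  (2 ^ i.*2 + b ^ j.*2 = c ^ z)%N -> z = 1%N \/ c = 5%N /\ b = 11%N.
Proof.
move=> b_pr c_pr c_odd b2 bc i0 j0 z_odd E.
have z0 : (0 < z)%N by case: (z) z_odd.
have pow_sq (a n : nat) : 1 * (a ^ n)%N%:Z ^+ 2 = (a ^ n.*2)%N%:Z.
  by rewrite mul1r -Posz_exp -expnM muln2.
have sumE : (2 ^ i)%N%:Z ^+ 2 + (b ^ j)%N%:Z ^+ 2 = c%:Z ^+ z.
  by rewrite -[_ ^+ 2]mul1r -[(b ^ j)%N%:Z ^+ 2]mul1r !pow_sq -PoszD E Posz_exp.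
have cb : ~~ (c %| (b ^ j)%N%:Z)%Z.
  rewrite dvdzE /= Euclid_dvdX // dvdn_prime2 // negb_and; apply/orP; left.
  by apply/eqP => cb; apply: bc.
have [x [y xyE]] := thue1 c_pr (dvd_pow_sum z0 sumE) cb.
have [u0 [v0 [u_even uvE]]] : exists u0 v0 : int, (2 %| u0)%Z /\
    c%:Z = 1 * u0 ^+ 2 + 1 * v0 ^+ 2.
  have two_odd : (2%N %| x)%Z || (2%N %| y)%Z.
    rewrite -[_ || _]negbK negb_or; apply/negP => /andP[x2 y2].
    have sq_odd (w : int) : ~~ (2%N %| w)%Z -> ~~ (2%N %| w ^+ 2)%Z.
      by move=> w2; rewrite Euclid_dvdzX // negb_and w2.
    move: (sq_odd _ x2) (sq_odd _ y2) c_odd xyE.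
    by move: (x ^+ 2) (y ^+ 2); clear; lia.
  case/orP: two_odd => ev; [exists x, y | exists y, x]; split=> //; rewrite !mul1r //.
  by rewrite addrC.
have c1 : ~~ (c %| 1)%Z by rewrite dvdzE /= dvdn1 gtn_eqF // prime_gt1.
have co : coprime 2 c by rewrite coprime_sym coprimen2.
have u_even2 : (2 %| 1 * u0 ^+ 2)%Z by rewrite mul1r expr2 dvdz_mulr.
have U_even : (2%N %| (2 ^ i)%N%:Z)%Z by rewrite dvdzE /= dvdn_exp.
have base : 1 < (1 * 1 : int) \/ [/\ (1 : int) = 1, (1 : int) = 1 & (1 < 2)%N] by right.
have [|[m [zE v1 u1 vq1]]] := rep_exponent_one c_pr c_odd b_pr b2 bc c1 c1
  ltr01 ltr01 co base uvE u_even u_even2 z_odd (pow_sq _ _) (pow_sq _ _) E U_even.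
  by left.
rewrite u1 v1 in uvE.
have cE : c = (2 ^ i.*2 + 1)%N by move: uvE; rewrite -PoszD => -[].
have even_pow : (2 %| (2 ^ i.*2)%N%:Z)%Z by rewrite dvdzE /= dvdn_exp // double_gt0.
rewrite uvE in vq1.
have [mE|mE] : m = m./2.*2 \/ m = m./2.*2.+1.
- by rewrite -{1 3}(odd_double_half m); case: (odd m); [right|left].
- by left; move: vq1; rewrite mE => /(vquo_unit_even even_pow) m0; rewrite zE mE m0.
right; case: i i0 E cE {pow_sq sumE U_even even_pow uvE u1} vq1 => // -[|i] _ E cE vq1.
- move: vq1; rewrite mE => /(@vquo_unit_odd 4) m0.
  have {}m0 : m = 1%N by rewrite mE m0 //; right.
  have c5 : c = 5%N by rewrite cE.
  split=> //; apply: (@prime_of_pow 11 b 2 j.*2) => //; first by rewrite double_gt0.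
  by move: E; rewrite zE m0 c5; clear; lia.
(* Modulo 5, [4 ^ i + 1] is 0 or 2, and 0 would mean [c = 5]. As [m] is odd, [z = 3] modulo 4 and
   [c ^ z = 3], so the square [b ^ j.*2] would be 2, a nonresidue. *)
- exfalso; have c5 : c <> 5%N.
    move=> c5; move: cE; rewrite c5 2!doubleS !expnS.
    have : (0 < 2 ^ i.*2)%N by rewrite expn_gt0.
    by clear; lia.
  have i_mod : (2 ^ i.+2.*2 %% 5 = if odd i then 4 else 1)%N.
    rewrite -mul2n expnM (pow_mod_period _ (_ : (2 ^ 2) ^ 2 = 1 %[mod 5])%N) // modn2 /= negbK.
    by case: (odd i).
  have c_mod : (c %% 5 = 2)%N.
    move: i_mod; rewrite cE; case: (odd i); last by clear; lia.
    move=> pw; case: c5; have : (5 %| c)%N by rewrite cE; move: pw; clear; lia.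
    by rewrite dvdn_prime2 // => /eqP.
  have pw1 : (2 ^ i.+2.*2 %% 5 = 1)%N by move: c_mod; rewrite cE; clear; lia.
  have cz : (c ^ z %% 5 = 3)%N.
    rewrite -modnXm c_mod (pow_mod_period z (_ : 2 ^ 4 = 1 %[mod 5])%N) //.
    have -> : (z %% 4 = 3)%N by move: zE mE; clear; lia.
    by [].
  have : (b ^ j.*2 %% 5 = 2)%N by move: E pw1 cz; clear; lia.
  rewrite -muln2 expnM -modnXm.
  have : ((b ^ j) %% 5 < 5)%N by rewrite ltn_mod.
  by move: ((b ^ j) %% 5)%N; do 5![case=> //].
Qed.

(** Since [3 = 2 + 1] has a trivial second part, the exceptional branch does occur; the 2-adic
    argument at [a = 2] leaves only [z = 3], that is [2 + 25 = 27]. *)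
Lemma two_plus_square_exp3 (b j z : nat) : prime b -> b <> 2%N -> b <> 3%N ->
  (0 < j)%N -> odd z -> (2 + b ^ j.*2 = 3 ^ z)%N -> b = 5%N.
Proof.
move=> b_pr b2 b3 j0 z_odd E.
have c1 : ~~ (3%N %| 1)%Z by []. have c2 : ~~ (3%N %| 2)%Z by [].
have VE : 1 * (b ^ j)%N%:Z ^+ 2 = (b ^ j.*2)%N%:Z.
  by rewrite mul1r -Posz_exp -expnM muln2.
have base : 1 < (2 * 1 : int) \/ [/\ (2 : int) = 1, (1 : int) = 1 & (1 < 1)%N] by left.
have cE : 3%N%:Z = 2 * 1 ^+ 2 + 1 * 1 ^+ 2 by [].
have UE : 2 * 1 ^+ 2 = (2 ^ 1)%N%:Z by [].
have one_dvd : (1%N %| 1)%Z by [].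
have u_even : (2 %| (2 * 1 ^+ 2 : int))%Z by [].
have E' : (2 ^ 1 + b ^ j.*2 = 3 ^ z)%N by [].
have b_of_z : z = 3%N -> b = 5%N.
  move=> z3; apply: (@prime_of_pow 5 b 2 j.*2) => //; first by rewrite double_gt0.
  by move: E; rewrite z3; clear; lia.
have not1 : z <> 1%N.
  move=> z1; move: E; rewrite z1.
  have : (1 < b ^ j.*2)%N by rewrite -(expn0 b) ltn_exp2l ?double_gt0 // prime_gt1.
  by clear; lia.
have [z1|[m [zE _ _ vq1]]] := rep_exponent_one (isT : prime 3) isT b_pr b2 b3 c2 c1
  (isT : 0 < (2 : int)) ltr01 (isT : coprime 1 3) base cE one_dvd u_even z_odd UE VE E' one_dvd.
  by case: not1.
have [mE|mE] : m = m./2.*2 \/ m = m./2.*2.+1.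
- by rewrite -{1 3}(odd_double_half m); case: (odd m); [right|left].
- move: vq1; rewrite mE => /(@vquo_unit_even 2) m0.
  by case: not1; rewrite zE mE m0.
- move: vq1; rewrite mE => /(@vquo_unit_odd 2) m0.
  by apply: b_of_z; rewrite zE mE m0 //; left.
Qed.

(** In the exceptional branch [c] would be [2 + 1 = 3]. *)
Lemma two_plus_exp3_exponent_one (c j z : nat) : prime c -> odd c -> c <> 3%N ->
  (0 < j)%N -> odd z -> (2 + 3 ^ j.*2 = c ^ z)%N -> z = 1%N.
Proof.
move=> c_pr c_odd c3 j0 z_odd E.
have z0 : (0 < z)%N by case: (z) z_odd.
have c1 : ~~ (c %| 1)%Z by rewrite dvdzE /= dvdn1 gtn_eqF // prime_gt1.
have c2 : ~~ (c %| 2)%Z.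
  by rewrite dvdzE /= dvdn_prime2 //; apply/eqP => c2; rewrite c2 in c_odd.
have VE : 1 * (3 ^ j)%N%:Z ^+ 2 = (3 ^ j.*2)%N%:Z.
  by rewrite mul1r -Posz_exp -expnM muln2.
have sumE : (3 ^ j)%N%:Z ^+ 2 + 2 * 1 ^+ 2 = c%:Z ^+ z.
  by rewrite -[_ ^+ 2]mul1r VE -Posz_exp -E addnC PoszD.
have [x [y cE]] := thue2 c_pr (dvd_pow_sum z0 sumE) c1.
have {}cE : c%:Z = 2 * x ^+ 2 + 1 * y ^+ 2 by rewrite mul1r.
have base : 1 < (2 * 1 : int) \/ [/\ (2 : int) = 1, (1 : int) = 1 & (1 < 1)%N] by left.
have UE : 2 * 1 ^+ 2 = (2 ^ 1)%N%:Z by [].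
have one_dvd (w : int) : (1%N %| w)%Z by rewrite dvd1z.
have u_even : (2 %| 2 * x ^+ 2)%Z by rewrite dvdz_mulr.
have E' : (2 ^ 1 + 3 ^ j.*2 = c ^ z)%N by [].
have three2 : (3 <> 2)%N by [].
have [//|[m [zE v1 u1 vq1]]] := rep_exponent_one c_pr c_odd (isT : prime 3)
  three2 (nesym c3) c2 c1 (isT : 0 < (2 : int)) ltr01
  (coprime1n c) base cE (one_dvd _) u_even z_odd UE VE E' (one_dvd _).
by case: c3; move: cE; rewrite v1 u1 -PoszD => -[].
Qed.

(** Doubling [2 * X ^ 2 + 3 * Y ^ 2] gives [(2 * X) ^ 2 + 6 * Y ^ 2], the shape required by [thue6].
    The exceptional branch would need [3 * y ^ 2 = 1]. *)
Lemma oo_exponent_one (c i j z : nat) : prime c -> (c %% 24 = 11)%N -> odd z ->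
  (2 ^ i.*2.+1 + 3 ^ j.*2.+1 = c ^ z)%N -> z = 1%N.
Proof.
move=> c_pr c24 z_odd E.
have z0 : (0 < z)%N by case: (z) z_odd.
have c_odd : odd c by move: c24; clear; lia.
have c3 : 3%N <> c by move: c24; clear; lia.
have c2 : ~~ (c %| 2)%Z.
  by rewrite dvdzE /= dvdn_prime2 //; apply/eqP => c2; rewrite c2 in c_odd.
have c3' : ~~ (c %| 3)%Z.
  by rewrite dvdzE /= dvdn_prime2 //; apply/eqP => c3'; apply: c3.
have pow_sq (a n : nat) : a%:Z * (a ^ n)%N%:Z ^+ 2 = (a ^ n.*2.+1)%N%:Z.
  by rewrite -Posz_exp -expnM muln2 expnS PoszM.
have sumE : (c %| (2 * (2 ^ i)%N%:Z) ^+ 2 + 6 * (3 ^ j)%N%:Z ^+ 2)%Z.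
  have -> : (2 * (2 ^ i)%N%:Z) ^+ 2 + 6 * (3 ^ j)%N%:Z ^+ 2 =
    2 * (2%N%:Z * (2 ^ i)%N%:Z ^+ 2 + 3%N%:Z * (3 ^ j)%N%:Z ^+ 2) by ring.
  by rewrite !pow_sq -PoszD E Posz_exp dvdz_mull // (dvd_pow_sum z0 erefl).
have c3j : ~~ (c %| (3 ^ j)%N%:Z)%Z.
  rewrite dvdzE /= Euclid_dvdX // dvdn_prime2 // negb_and; apply/orP; left.
  by apply/eqP => cb; apply: c3.
have [x [y cE]] := thue6 c_pr c24 sumE c3j.
have base : 1 < (2 * 3 : int) \/ [/\ (2 : int) = 1, (3 : int) = 1 & (1 < 1)%N] by left.
have one_dvd (w : int) : (1%N %| w)%Z by rewrite dvd1z.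
have u_even : (2 %| 2 * x ^+ 2)%Z by rewrite dvdz_mulr.
have three2 : (3 <> 2)%N by [].
have [//|[m [zE v1 _ _]]] := rep_exponent_one c_pr c_odd (isT : prime 3)
  three2 c3 c2 c3' (isT : 0 < (2 : int)) (isT : 0 < (3 : int))
  (coprime1n c) base cE (one_dvd _) u_even z_odd (pow_sq 2 i) (pow_sq 3 j) E (one_dvd _).
by move: v1; move: (y ^+ 2); clear; lia.
Qed.

Local Close Scope ring_scope.

(** * The theorem *)

Section BaseTwo.
Variables b c : nat.
Hypotheses (b_pr : prime b) (c_pr : prime c) (b2 : b <> 2) (c2 : c <> 2) (bc : b <> c).

Lemma base_two_class_unique t1 t2 : is_sol 2 b c t1 -> is_sol 2 b c t2 ->
  odd t1.1.1 = odd t2.1.1 -> odd t1.1.2 = odd t2.1.2 -> t1 = t2.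
Proof.
case: t1 => [[x y] z]; case: t2 => [[x' y'] z'] /=.
move=> [x0 [y0 [z0 E]]] [x0' [y0' [z0' E']]] oxE oyE.
have reg : ~ (c = 2 /\ (2 * b = 15 \/ 2 * b = 39)) by case.
have [-> -> ->//] := parity_class_unique (isT : prime 2) b_pr c_pr (nesym b2)
  (nesym c2) bc reg x0 y0 z0 E x0' y0' z0' E' oxE oyE.
Qed.

(** For odd [y], divisibility of [c ^ z] by 3 must be avoided. For even [y] one has [b ^ y = 1]
    modulo 24, which leaves the residues 5 and 17 for [c ^ z]; this is the origin of [5] modulo
    12. *)
Lemma sol_mod3 x y z : b <> 3 -> c <> 3 -> is_sol 2 b c (x, y, z) ->
  if odd y then odd x = (b %% 3 == 2) else [/\ odd x = false, odd z & c %% 12 = 5].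
Proof.
move=> b3 c3 [x0 [y0 [z0 E]]].
have [b_odd b_mod] := prime_mod_6 b_pr b2 b3; have [c_odd c_mod] := prime_mod_6 c_pr c2 c3.
have := exp2_mod24 x0; have := pow_mod24 y b_odd b_mod; have := pow_mod24 z c_odd c_mod.
have x1E : x == 1 -> odd x by move/eqP->.
have x2E : x == 2 -> odd x = false by move/eqP->.
move: E b_mod c_mod x1E x2E; move: (2 ^ x) (b ^ y) (c ^ z); clear.
case: (odd y); case: (odd z); case: (x == 1); case: (x == 2); case: (odd x) => /= *;
  by try split; lia.
Qed.

(** Even [y] is left with [2 + 25 = 27] when [x = 1], and otherwise with a difference of squares
    leading to [32 + 49 = 81]; hence the exclusion of 5 and 7. *)
Lemma sol_exp3 x y z : b <> 3 -> b <> 5 -> b <> 7 -> c = 3 ->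
  is_sol 2 b c (x, y, z) -> odd y /\ odd x = (b %% 3 == 1).
Proof.
move=> b3 b5 b7 -> [x0 [y0 [z0 E]]].
have [b_odd b_mod] := prime_mod_6 b_pr b2 b3.
have mod2 := exp2_mod24 x0; have modb := pow_mod24 y b_odd b_mod.
have mod3 := exp3_mod24 z0.
have [y_odd|y_even] := boolP (odd y).
  split=> //; have x1E : x == 1 -> odd x by move/eqP->.
  have x2E : x == 2 -> odd x = false by move/eqP->.
  move: E b_mod x1E x2E mod2 modb mod3; rewrite y_odd; move: (2 ^ x) (b ^ y) (3 ^ z); clear.
  by case: (odd z); case: (x == 1); case: (x == 2); case: (odd x); lia.
exfalso; have yE : y = y./2.*2 by rewrite -{1}(odd_double_half y) (negbTE y_even).
have h0 : 0 < y./2 by move: y0 yE; clear; lia.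
rewrite (negbTE y_even) in modb.
have [x1|x_gt1] : x = 1 \/ 1 < x by move: x0; clear; lia.
  have z_odd : odd z.
    move: E mod2 modb mod3; rewrite x1; move: (b ^ y) (3 ^ z); clear.
    by case: (odd z) => //; lia.
  by apply: b5; apply: (two_plus_square_exp3 b_pr b2 b3 h0 z_odd); rewrite -yE -E x1.
have z_even : odd z = false.
  have x1F : (x == 1) = false by move: x_gt1; clear; lia.
  move: E mod2 modb mod3; rewrite x1F; move: (2 ^ x) (b ^ y) (3 ^ z); clear.
  by case: (odd z); case: (x == 2); case: (odd x); lia.
have zE : z = z./2.*2 by rewrite -{1}(odd_double_half z) z_even.
have {}E : 2 ^ x + (b ^ y./2) ^ 2 = (3 ^ z./2) ^ 2 by rewrite -!expnM !muln2 -yE -zE.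
have Bodd : odd (b ^ y./2) by rewrite oddX b_odd orbT.
have [n [_ BE CE]] := diff_squares_exp2 Bodd x0 E.
have B1 : 1 < b ^ y./2 by rewrite -(expn0 b) ltn_exp2l // prime_gt1.
have [n1|n3] := exp2_add1_exp3 (esym CE).
  by move: BE B1; rewrite n1; clear; lia.
apply: b7; apply: (@prime_of_pow 7 b 1 y./2) => //.
by move: BE; rewrite n3; clear; lia.
Qed.

End BaseTwo.

(** An even [z] forces [y] to be even modulo 24, and the difference of squares is then
    [16 = 25 - 9]. *)
Lemma base_three_odd_exponent c x y z : prime c -> c <> 2 -> c <> 3 -> c <> 5 ->
  is_sol 2 3 c (x, y, z) -> odd z.
Proof.
move=> c_pr c2 c3 c5 [x0 [y0 [z0 E]]].
have [c_odd c_mod] := prime_mod_6 c_pr c2 c3.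
apply/negPn/negP => z_even; have := pow_mod24 z c_odd c_mod; rewrite (negbTE z_even).
have mod2 := exp2_mod24 x0; have mod3 := exp3_mod24 y0 => modc.
have [y_odd|y_even] := boolP (odd y).
  move: E mod2 mod3 modc; rewrite y_odd; move: (2 ^ x) (3 ^ y) (c ^ z); clear.
  by case: (x == 1); case: (x == 2); case: (odd x); lia.
have yE : y = y./2.*2 by rewrite -{1}(odd_double_half y) (negbTE y_even).
have zE : z = z./2.*2 by rewrite -{1}(odd_double_half z) (negbTE z_even).
have h0 : 0 < y./2 by move: y0 yE; clear; lia.
have k0 : 0 < z./2 by move: z0 zE; clear; lia.
have {}E : 2 ^ x + (3 ^ y./2) ^ 2 = (c ^ z./2) ^ 2 by rewrite -!expnM !muln2 -yE -zE.
have Bodd : odd (3 ^ y./2) by rewrite oddX orbT.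
have [n [_ BE CE]] := diff_squares_exp2 Bodd x0 E.
have n2 : n = 2.
  have := exp3_mod24 h0; have : 3 ^ 1 <= 3 ^ y./2 by rewrite leq_exp2l.
  case: n BE {CE} => [|[|[|n]]] //; rewrite ?expnS ?expn0.
  - by clear; lia.
  - by clear; lia.
  - by move: (3 ^ y./2) (2 ^ n); clear; case: (odd _); lia.
by apply: c5; apply: (@prime_of_pow 5 c 1 z./2) => //; rewrite CE n2.
Qed.

(** As the exponents of [c] are odd, [2 ^ x + 3 ^ y = c] modulo 24. The residues are 5, 7, 11, 19
    for odd [y] and 11, 13, 17, 1 for even [y], so different parity classes meet only at 11, in the
    situation of [key]; there both exponents of [c] are 1 and [pillai_2_3] gives [c = 11]. *)
Lemma base_three_unique c t1 t2 : prime c -> c <> 2 -> c <> 3 -> c <> 5 -> c <> 11 ->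
  is_sol 2 3 c t1 -> is_sol 2 3 c t2 -> t1 = t2.
Proof.
move=> c_pr c2 c3 c5 c11.
have [c_odd c_mod] := prime_mod_6 c_pr c2 c3.
have three_pr : prime 3 by []. have three2 : 3 <> 2 by [].
have key x y z x' y' z' : is_sol 2 3 c (x, y, z) -> is_sol 2 3 c (x', y', z') ->
    x = 1 -> odd y = false -> 2 < x' -> odd x' -> odd y' -> c %% 24 = 11 -> False.
  move=> s s' x1 y_even x3 x_odd' y_odd' c24.
  have z_odd := base_three_odd_exponent c_pr c2 c3 c5 s.
  have z_odd' := base_three_odd_exponent c_pr c2 c3 c5 s'.
  case: s => [_ [y0 [_ E]]]; case: s' => [_ [_ [_ E']]].
  have yE : y = y./2.*2 by rewrite -{1}(odd_double_half y) y_even.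
  have h0 : 0 < y./2 by move: y0 yE; clear; lia.
  have z1 : z = 1.
    apply: (two_plus_exp3_exponent_one c_pr c_odd c3 h0 z_odd).
    by rewrite -yE -E x1.
  have z1' : z' = 1.
    apply: (@oo_exponent_one c x'./2 y'./2 z' c_pr c24 z_odd').
    rewrite -E'; congr (2 ^ _ + 3 ^ _).
      by rewrite -[RHS](odd_double_half x') x_odd'.
    by rewrite -[RHS](odd_double_half y') y_odd'.
  move: E E'; rewrite x1 z1 z1' !expn1 => E E'.
  apply: c11; rewrite -E'; apply: (pillai_2_3 x3 y_even y_odd' y0).
  by rewrite E E'.
case: t1 => [[x y] z]; case: t2 => [[x' y'] z'] s s'.
have uniq := base_two_class_unique three_pr c_pr three2 c2 (nesym c3) s s'.
have z_odd := base_three_odd_exponent c_pr c2 c3 c5 s.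
have z_odd' := base_three_odd_exponent c_pr c2 c3 c5 s'.
have k1 := key _ _ _ _ _ _ s s'; have k2 := key _ _ _ _ _ _ s' s.
case: s => [x0 [y0 [_ E]]]; case: s' => [x0' [y0' [_ E']]].
have := pow_mod24 z c_odd c_mod; rewrite z_odd.
have := pow_mod24 z' c_odd c_mod; rewrite z_odd'.
have := exp2_mod24 x0; have := exp2_mod24 x0'.
have := exp3_mod24 y0; have := exp3_mod24 y0'.
have x1E : x == 1 -> odd x by move/eqP->.
have x2E : x == 2 -> odd x = false by move/eqP->.
have x1E' : x' == 1 -> odd x' by move/eqP->.
have x2E' : x' == 2 -> odd x' = false by move/eqP->.
rewrite /= in uniq; move: E E' => <- <-.
have [/andP[/eqP ox /eqP oy]|ne] :=
  boolP ((odd x == odd x') && (odd y == odd y')); first by rewrite uniq.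
move=> my' my mx' mx mc' mc; exfalso.
suff [[? [? [? [? [? ?]]]]]|[? [? [? [? [? ?]]]]]] :
   (x = 1 /\ odd y = false /\ 2 < x' /\ odd x' /\ odd y' /\ c %% 24 = 11) \/
   (x' = 1 /\ odd y' = false /\ 2 < x /\ odd x /\ odd y /\ c %% 24 = 11).
- exact: k1.
- exact: k2.
have gt2 n : 0 < n -> (n == 1) = false -> (n == 2) = false -> 2 < n by clear; lia.
have g := gt2 x x0; have g' := gt2 x' x0'.
have e1 : x == 1 -> x = 1 by move/eqP. have e1' : x' == 1 -> x' = 1 by move/eqP.
move: my' my mx' mx mc' mc ne x1E x2E x1E' x2E' g g' e1 e1'.
move: (2 ^ x) (2 ^ x') (3 ^ y) (3 ^ y') => X X' Y Y'.
clear; move: (c %% 24) => d.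
case: (odd y); case: (odd y'); case: (odd x); case: (odd x');
  case: (x == 1); case: (x == 2); case: (x' == 1); case: (x' == 2) => //=;
  clear; intuition lia.
Qed.

Theorem theorem1p4 (a b c : nat) :
  prime a -> prime b -> prime c ->
  a <> c -> b <> c -> a < b ->
  N_gt1 a b c ->
  (a, b, c) \notin [:: (2, 3, 5); (2, 3, 11); (2, 5, 3); (2, 7, 3); (3, 5, 2); (3, 13, 2)] ->
  c = 5 %[mod 12] /\
  exists x1 y1 z1 x2 y2 z2 : nat,
    [/\ is_sol a b c (x1, y1, z1), is_sol a b c (x2, y2, z2),
        (x1, y1, z1) <> (x2, y2, z2),
        (forall t, is_sol a b c t -> t = (x1, y1, z1) \/ t = (x2, y2, z2)) &
        [/\ 2 %| x1, 2 %| y1, z1 = 1 & ~~ (2 %| y2)]].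
Proof.
move=> a_pr b_pr c_pr ac bc ab [t1 [t2 [t12 [s1 s2]]]] exc.
have b2 : b <> 2 by move=> b2; have := prime_gt1 a_pr; move: ab; rewrite b2; clear; lia.
have [c2|c2] := eqVneq c 2.
  exfalso; apply: t12; rewrite c2 in ac s1 s2 exc.
  move: s1 s2; case: t1 => [[x y] z]; case: t2 => [[x' y'] z'].
  move=> [x0 [y0 [z0 E]]] [x0' [y0' [z0' E']]].
  have reg : ~ (a * b = 15 \/ a * b = 39).
    move=> abE; have a7 : a < 7 by move: ab abE; clear; nia.
    have [a3|a3] : a = 3 \/ a <> 3 by case: (eqVneq a 3) => [|/eqP]; [left|right].
      have [bE|bE] : b = 5 \/ b = 13 by move: abE; rewrite a3; clear; lia.
        by rewrite a3 bE in exc.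
      by rewrite a3 bE in exc.
    move: a_pr ac a3 a7 abE ab; clear; case: a => [|[|[|[|[|[|[|a]]]]]]] //.
    by move=> _ _ _ _; lia.
  have ab' : a <> b by move: ab; clear; lia.
  by have [-> -> ->] := power_of_two_unique a_pr b_pr ab' ac b2 reg
    x0 y0 z0 E x0' y0' z0' E'.
have {}c2 : c <> 2 by apply/eqP.
have a2 : a = 2.
  case: (even_prime a_pr) => // a_odd; exfalso.
  have [b_odd _] := odd_prime_ge3 b_pr b2; have [c_odd _] := odd_prime_ge3 c_pr c2.
  move: s1; case: t1 {t12} => [[x y] z] [_ [_ [_ /(congr1 odd)]]].
  by rewrite oddD !oddX a_odd b_odd c_odd !orbT.
move: ab exc s1 s2 {a_pr ac}; rewrite a2 {a2} => _ exc s1 s2.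
have [b3|/eqP b3] := eqVneq b 3.
  exfalso; apply: t12; rewrite b3 in bc s1 s2 exc.
  apply: (@base_three_unique c) => //; first exact: nesym.
  - by move=> c5; rewrite c5 in exc.
  - by move=> c11; rewrite c11 in exc.
have [c3|/eqP c3] := eqVneq c 3.
  exfalso; apply: t12.
  have b5 : b <> 5 by move=> b5; rewrite b5 c3 in exc.
  have b7 : b <> 7 by move=> b7; rewrite b7 c3 in exc.
  apply: (base_two_class_unique b_pr c_pr b2 c2 bc s1 s2).
    move: s1 s2; case: t1 => [[x y] z]; case: t2 => [[x' y'] z'] s1 s2 /=.
    have [_ ->] := sol_exp3 b_pr b2 b3 b5 b7 c3 s1.
    by have [_ ->] := sol_exp3 b_pr b2 b3 b5 b7 c3 s2.
  move: s1 s2; case: t1 => [[x y] z]; case: t2 => [[x' y'] z'] s1 s2 /=.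
  have [-> _] := sol_exp3 b_pr b2 b3 b5 b7 c3 s1.
  by have [-> _] := sol_exp3 b_pr b2 b3 b5 b7 c3 s2.
have class t : is_sol 2 b c t -> if odd t.1.2 then odd t.1.1 = (b %% 3 == 2)
    else [/\ odd t.1.1 = false, odd t.2 & c %% 12 = 5].
  by case: t => [[x y] z] /(sol_mod3 b_pr c_pr b2 c2 b3 c3).
have same t t' : is_sol 2 b c t -> is_sol 2 b c t' -> odd t.1.2 = odd t'.1.2 -> t = t'.
  move=> s s' oE; apply: (base_two_class_unique b_pr c_pr b2 c2 bc s s') => //.
  have := class _ s; have := class _ s'; rewrite oE.
  by case: (odd _) => [-> ->|[-> _ _] [-> _ _]].
have [u [v [su sv uy vy]]] : exists u v, [/\ is_sol 2 b c u, is_sol 2 b c v,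
    odd u.1.2 = false & odd v.1.2].
  case o1: (odd t1.1.2); case o2: (odd t2.1.2).
  - by case: t12; apply: same => //; rewrite o1 o2.
  - by exists t2, t1.
  - by exists t1, t2.
  - by case: t12; apply: same => //; rewrite o1 o2.
have := class _ su; rewrite uy => -[ux uz c5].
have vx := class _ sv; rewrite vy in vx.
split; first by rewrite c5.
have [c_odd _] := odd_prime_ge3 c_pr c2.
move: su sv uy vy ux uz vx; case: u => [[x1 y1] z1]; case: v => [[x2 y2] z2] /=.
move=> su sv y1_even y2_odd x1_even z1_odd x2E.
have z1E : z1 = 1.
  have [x10 [y10 [z10 E]]] := su.
  have x1E : x1 = x1./2.*2 by rewrite -{1}(odd_double_half x1) x1_even.
  have y1E : y1 = y1./2.*2 by rewrite -{1}(odd_double_half y1) y1_even.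
  have i0 : 0 < x1./2 by move: x10 x1E; clear; lia.
  have j0 : 0 < y1./2 by move: y10 y1E; clear; lia.
  rewrite x1E y1E in E.
  have [//|[cE bE]] := ee_exponent_one b_pr c_pr c_odd b2 bc i0 j0 z1_odd E.
  (* For [c = 5] and [b = 11] the second solution is impossible: [x2] is odd, so [2 ^ x2] is 2 or 3
     modulo 5, whereas [11 ^ y2] is 1. *)
  exfalso; have [_ [_ [z20 E2]]] := sv; rewrite bE /= in x2E; rewrite cE bE in E2.
  have : 2 ^ x2 = 2 ^ (x2 %% 4) %[mod 5] by apply: pow_mod_period.
  have : x2 %% 4 = 1 \/ x2 %% 4 = 3 by move: x2E; clear; lia.
  have : 11 ^ y2 %% 5 = 1 by rewrite -modnXm exp1n.
  have : 5 ^ z2 %% 5 = 0 by rewrite -(prednK z20) expnS modnMr.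
  move: E2; move: (2 ^ x2) (11 ^ y2) (5 ^ z2) => X Y Z E2 Z5 Y5.
  by case=> -> /=; move: E2 Z5 Y5; clear; lia.
exists x1, y1, z1, x2, y2, z2; split=> //.
- by case=> _ y12 _; move: y1_even; rewrite y12 y2_odd.
- move=> t st; case ty: (odd t.1.2).
    by right; apply: same => //=; rewrite ty y2_odd.
  by left; apply: same => //=; rewrite ty y1_even.
- by rewrite !dvdn2 x1_even y1_even y2_odd.
Qed.
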